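(* Let $d\ge1$ and let $B$ be a centered, isotropic, jointly measurable Gaussian field on $S^d$ with continuous covariance function $\kappa:[-1,1]\to\mathbb R$, $\mathbb E[B_xB_y]=\kappa(\langle x,y\rangle)$, $\kappa(1)=1$. Suppose there exist $C_1,C_2,\alpha,\epsilon>0$ such that $|\kappa(t)|<1$ for all $t\neq1$ and $$C_1|\theta|^\alpha\le 1-\kappa(\cos\theta)\le C_2|\theta|^\alpha\qquad\text{for }|\theta|\le\epsilon.$$ Let $\mu$ be the volume measure on $S^d$ and $V(u)=\int_{S^d}\mathbf 1_{\{B_x\ge u\}}\mu(dx)$. Then for every $u\in\mathbb R$ and $p\in\mathbb N$: $V(u)\in\mathbb D^{p,2}$ if and only if $p<d/\alpha+\tfrac12$.
   Context: Hermite polynomials: $H_0=1$, $H_1(x)=x$, $H_{q+1}(x)=xH_q(x)-qH_{q-1}(x)$; $\phi(x)=e^{-x^2/2}/\sqrt{2\pi}$. For $\varphi\in L^2(\mathbb R,\phi(x)dx)$, $a_q(\varphi)=\frac1{q!}\int_{\mathbb R}H_q\varphi\phi\,dx$, and for $Y(\varphi)=\int_{S^d}\varphi(B_x)\mu(dx)$ one says $Y(\varphi)\in\mathbb D^{p,2}$ iff $\sum_{q\ge0}q^p\,q!\,a_q(\varphi)^2\int_{(S^d)^2}\kappa(\langle x,y\rangle)^q\,\mu(dx)\mu(dy)<\infty$. Here $V(u)=Y(\mathbf 1_{[u,\infty)})$. Isotropic means the law of $B$ is invariant under rotations. *)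

(* Defs.v *)
From HB Require Import structures.
From mathcomp Require Import all_boot all_order all_algebra.
From mathcomp Require Import all_classical all_reals all_analysis.
Set Implicit Arguments. Unset Strict Implicit. Unset Printing Implicit Defensive.
Import Order.TTheory GRing.Theory Num.Theory.
Import numFieldNormedType.Exports.
Local Open Scope classical_set_scope.
Local Open Scope ring_scope.

Section Defs.
Variable R : realType.

Definition dotv n (x y : 'rV[R]_n) : R := \sum_(i < n) x ord0 i * y ord0 i.
Definition enorm n (x : 'rV[R]_n) : R := Num.sqrt (dotv x x).

Definition sphere (d : nat) : set 'rV[R]_d.+1 := [set x | enorm x = 1].

(** Borel sigma-algebra on R^(d+1) (generated by the open sets of the
    usual (product) topology); the sphere carries the trace of it. *)
Definition BorelRV (d : nat) := g_sigma_algebraType (@open 'rV[R]_d.+1).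

Definition setc m (x : 'rV[R]_m) (i : 'I_m) (t : R) : 'rV[R]_m :=
  \row_j (if j == i then t else x ord0 j).

Fixpoint iint (m : nat) (k : nat) (f : 'rV[R]_m.+1 -> \bar R)
    (x : 'rV[R]_m.+1) : \bar R :=
  match k with
  | 0 => f x
  | k'.+1 => (\int[lebesgue_measure]_t iint k' f (setc x (inord k') t))%E
  end.

Definition leb_int (m : nat) (f : 'rV[R]_m.+1 -> \bar R) : \bar R :=
  iint m.+1 f 0.

(** Integral against the volume (surface) measure mu of S^d, via the
    cone formula  int_{S^d} g dmu = (d+1) int_{|x|<=1} g(x/|x|) dx. *)
Definition sphere_int (d : nat) (g : 'rV[R]_d.+1 -> \bar R) : \bar R :=
  ((d.+1)%:R%:E * leb_int (fun x : 'rV[R]_d.+1 => if (x != (0%R : 'rV[R]_d.+1)) && (enorm x <= 1)%R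
                                     then g ((enorm x)^-1 *: x)%R else 0%E))%E.

(** Probabilists' Hermite polynomials: hermite2 q x = (H_q x, H_(q+1) x). *)
Fixpoint hermite2 (q : nat) (x : R) : R * R :=
  match q with
  | 0 => (1, x)
  | q'.+1 => let: (a, b) := hermite2 q' x in (b, x * b - q'.+1%:R * a)
  end.
Definition hermite (q : nat) (x : R) : R := (hermite2 q x).1.

Definition gdens (x : R) : R := expR (- (x ^+ 2) / 2) / Num.sqrt (pi *+ 2).

Definition hcoef (phi : R -> R) (q : nat) : R :=
  (q`!%:R)^-1 * (\int[lebesgue_measure]_x (hermite q x * phi x * gdens x)).

Definition kint (d : nat) (kappa : R -> R) (q : nat) : \bar R :=
  sphere_int (fun x : 'rV[R]_d.+1 => sphere_int (fun y : 'rV[R]_d.+1 => (kappa (dotv x y) ^+ q)%:E)).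

(** Y(phi) in D^{p,2} (as defined in the paper, via the chaos expansion). *)
Definition in_Dp2 (d : nat) (kappa : R -> R) (p : nat) (phi : R -> R) : Prop :=
  (\sum_(0 <= q <oo)
     ((q%:R ^+ p * q`!%:R * hcoef phi q ^+ 2)%:E * kint d kappa q)%E < +oo)%E.

Definition ind_ge (u : R) (x : R) : R := if u <= x then 1 else 0.

Definition gauss_law (v : R) (A : set R) : \bar R :=
  if v == 0 then \d_(0:R) A else normal_prob 0 (Num.sqrt v) A.

Definition lincomb (d : nat) (T : Type) (B : 'rV[R]_d.+1 -> T -> R)
    (cs : seq ('rV[R]_d.+1 * R)) (w : T) : R :=
  \sum_(xc <- cs) xc.2 * B xc.1 w.

End Defs.

(* Main.v *)
Require Import Defs.
From HB Require Import structures.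
From mathcomp Require Import all_boot all_order all_algebra.
From mathcomp Require Import all_classical all_reals all_analysis.
From mathcomp Require Import measurable_realfun ring lra zify.
Set Implicit Arguments. Unset Strict Implicit. Unset Printing Implicit Defensive.
Import Order.TTheory GRing.Theory Num.Theory.
Import numFieldNormedType.Exports.
Local Open Scope classical_set_scope.
Local Open Scope ring_scope.

(** The coefficient of [1_{[u,oo)}] is [a_q = H_{q-1}(u) phi(u) / q!], so the q-th
    term of the series is [q^p phi(u)^2 H_{q-1}(u)^2 / q!] times the double
    integral of [kappa^q].  On average over two consecutive indices
    [H_q(u)^2 / q!] is of order [q^{-1/2}], and the double integral is of order
    [q^{-d/alpha}], because [kappa^q] is of order one exactly when the distance
    of [x] and [y] is at most of order [q^{-1/alpha}].  Hence the series
    behaves like the sum of the [q^{p - 3/2 - d/alpha}].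

    The order of the double integral comes from sandwiching [kappa^q] between
    finite sums of indicators of cubes: iterated integrals of these do not
    depend on the order of integration, so neither Fubini's theorem nor the
    rotation invariance of the surface measure is needed. *)

(** * Hermite coefficients of a half-line *)

Section Hermite.
Variable R : realType.
Implicit Types (q : nat) (x u : R).

(** At the critical value [p = d / alpha + 1/2] the terms are of harmonic order, so both factors
    have to be bounded by pure powers; a logarithmic loss could spoil the equivalence. Two obstacles
    shape the proof. [H_q u] can vanish for infinitely many [q] (every odd [q] if [u = 0]), so a
    lower bound is possible only for pairs of indices; it comes from a quadratic form in [H_n u] and
    [H_(n+1) u] with an exact increment, instead of oscillating asymptotics. And odd powers of
    [kappa] can be negative away from the diagonal; there they are at least [- rho ^+ q] with
    [rho < 1], which is negligible against [q^{-d/alpha}]. *)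

Lemma hermite0 x : hermite 0 x = 1. Proof. by []. Qed.
Lemma hermite1 x : hermite 1 x = x. Proof. by []. Qed.

Lemma hermite2E q x : hermite2 q x = (hermite q x, hermite q.+1 x).
Proof. by rewrite /hermite /=; case: (hermite2 q x). Qed.

Lemma hermiteSS q x :
  hermite q.+2 x = x * hermite q.+1 x - q.+1%:R * hermite q x.
Proof. by rewrite {1}/hermite /= hermite2E. Qed.

Lemma is_derive_hermite q x :
  is_derive x 1 (hermite q : R -> R) (q%:R * hermite q.-1 x).
Proof.
suff [] : is_derive x 1 (hermite q : R -> R) (q%:R * hermite q.-1 x) /\
  is_derive x 1 (hermite q.+1 : R -> R) (q.+1%:R * hermite q x) by [].
elim: q => [|q [IH1 IH2]].
  split; first by rewrite mul0r; apply: is_derive_cst.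
  by rewrite mul1r; apply: is_derive_id.
split => //.
have -> : (hermite q.+2 : R -> R) =
    (id \* hermite q.+1) \- (q.+1%:R \*: hermite q).
  by apply/funext => y; rewrite hermiteSS.
apply: is_derive_eq.
rewrite /GRing.scale /= !mulr1.
case: q {IH1 IH2} => [|q]; first by rewrite hermite0 hermite1; ring.
by rewrite hermiteSS -!natr1 /=; ring.
Qed.

Lemma gdens_gt0 x : 0 < gdens x.
Proof. by rewrite /gdens divr_gt0 ?expR_gt0// sqrtr_gt0 pmulrn_lgt0// pi_gt0. Qed.

Lemma is_derive_gdens x : is_derive x 1 (@gdens R) (- x * gdens x).
Proof.
have -> : @gdens R = (Num.sqrt (pi *+ 2))^-1 \*: (expR \o (fun y => (- 2^-1) * y ^+ 2)).
  by apply/funext => y; rewrite /gdens /= /GRing.scale /= mulrC; congr (_ * expR _); field.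
apply: is_derive_eq.
rewrite /gdens /= /GRing.scale /=.
have -> : - 2^-1 * x ^+ 2 = - x ^+ 2 / 2 :> R by field.
field.
by rewrite gt_eqF// sqrtr_gt0 pmulrn_lgt0// pi_gt0.
Qed.

(** Rodrigues' relation as an antiderivative: [(H_q phi)' = (H_q' - x H_q) phi], and
    [H_q' = q H_(q-1)] turns the bracket into [- H_(q+1)]. *)
Lemma is_derive_hermite_gdens q x :
  is_derive x 1 (fun y => - (hermite q y * gdens y) : R)
    (hermite q.+1 x * gdens x).
Proof.
have h1 := is_derive_hermite q x; have h2 := is_derive_gdens x.
have -> : (fun y => - (hermite q y * gdens y) : R) = - (hermite q \* @gdens R) by [].
apply: is_derive_eq.
rewrite /GRing.scale /=.
case: q {h1} => [|q]; first by rewrite hermite0 hermite1; ring.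
by rewrite hermiteSS /=; ring.
Qed.

Lemma norm_le_expR_sqr (e x : R) : 0 < e -> `|x| <= (1 + e^-1) * expR (e * x ^+ 2).
Proof.
move=> e0.
have h1 : `|x| <= 1 + x ^+ 2.
  by rewrite -real_normK ?num_real//; have := normr_ge0 x; nra.
apply: (le_trans h1).
have h2 := expR_ge1Dx (e * x ^+ 2).
have ei : 0 < e^-1 by rewrite invr_gt0.
apply: (@le_trans _ _ ((1 + e^-1) * (1 + e * x ^+ 2))); last first.
  by rewrite ler_pM2l// addr_gt0.
have -> : (1 + e^-1) * (1 + e * x ^+ 2) = 1 + e^-1 + e * x ^+ 2 + x ^+ 2.
  by field; rewrite gt_eqF.
by have := mulr_ge0 (ltW e0) (sqr_ge0 x); lra.
Qed.

(** Stated for every [e] because the factor [x] in the recurrence costs half of the exponent: the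
    induction hypothesis is used at [e / 2]. *)
Lemma hermite_bound q (e : R) : 0 < e ->
  exists2 C, 0 < C & forall x, `|hermite q x| <= C * expR (e * x ^+ 2).
Proof.
move=> e0.
suff [] : (exists2 C : R, 0 < C & forall x, `|hermite q x| <= C * expR (e * x ^+ 2)) /\
  (exists2 C : R, 0 < C & forall x, `|hermite q.+1 x| <= C * expR (e * x ^+ 2)) by [].
have ex (f : R) y : 0 < f -> 1 <= expR (f * y ^+ 2).
  move=> f0; rewrite -[leLHS]expR0 ler_expR.
  by apply: mulr_ge0 (ltW f0) (sqr_ge0 _).
elim: q e e0 => [|q IH] e e0.
  split.
    by exists 1 => // x; rewrite hermite0 normr1 mul1r ex.
  exists (1 + e^-1); first by rewrite addr_gt0// invr_gt0.
  by move=> x; rewrite hermite1; apply: norm_le_expR_sqr.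
have [[C0 C00 H0] [C1 C10 H1]] := IH (e / 2) (divr_gt0 e0 (ltr0n _ 2)).
have e20 : 0 < e / 2 by rewrite divr_gt0.
split; first by have [_ ?] := IH _ e0.
exists ((1 + (e / 2)^-1) * C1 + q.+1%:R * C0).
  by rewrite addr_gt0// mulr_gt0// addr_gt0// invr_gt0.
move=> x; rewrite hermiteSS.
have E : expR (e * x ^+ 2) = expR (e / 2 * x ^+ 2) * expR (e / 2 * x ^+ 2).
  by rewrite -expRD; congr expR; field.
rewrite mulrDl; apply: (le_trans (ler_normB _ _)); apply: lerD.
  rewrite normrM E mulrACA; apply: ler_pM => //; exact: norm_le_expR_sqr.
rewrite normrM normr_nat -mulrA ler_pM2l//; apply: (le_trans (H0 x)).
by rewrite ler_pM2l// E ler_peMr ?expR_ge0// ex.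
Qed.

(** The normal density of standard deviation 2 serves as integrable majorant: [exp (x^2 / 8)] times
    [exp (- x^2 / 2)] is at most [exp (- x^2 / 8)]. *)
Lemma hermite_gdens_bound q :
  exists2 C, 0 < C & forall x, `|hermite q x * gdens x| <= C * normal_pdf 0 2 x.
Proof.
have e0 : 0 < 8^-1 :> R by rewrite invr_gt0.
have [C C0 H] := hermite_bound q e0.
have s0 : 0 < Num.sqrt (pi *+ 2) :> R by rewrite sqrtr_gt0 pmulrn_lgt0// pi_gt0.
exists (C / Num.sqrt (pi *+ 2) / normal_peak 2).
  by rewrite !divr_gt0// normal_peak_gt0.
move=> x; rewrite normal_pdfE// normrM (ger0_norm (ltW (gdens_gt0 _))).
rewrite /normal_fun subr0 /gdens.
apply: (@le_trans _ _ (C * expR (8^-1 * x ^+ 2) * (expR (- x ^+ 2 / 2) / Num.sqrt (pi *+ 2)))).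
  by rewrite ler_pM2r// divr_gt0// expR_gt0.
have np : 0 < normal_peak 2 :> R by rewrite normal_peak_gt0.
rewrite [leRHS]mulrA divfK ?gt_eqF// mulrA [leRHS]mulrAC.
rewrite ler_pM2r ?invr_gt0// -mulrA ler_pM2l// -expRD ler_expR.
by have := sqr_ge0 x; lra.
Qed.

Lemma continuous_hermite_gdens q : continuous (fun x : R => hermite q x * gdens x).
Proof.
move=> x; apply: differentiable_continuous; apply/derivable1_diffP.
have h1 := is_derive_hermite q x; have h2 := is_derive_gdens x.
exact: derivableM.
Qed.

Lemma measurable_hermite_gdens q :
  measurable_fun setT (fun x : R => hermite q x * gdens x).
Proof.
exact: measurable_realfun.continuous_measurable_fun (@continuous_hermite_gdens q).
Qed.

Lemma integrable_hermite_gdens q :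
  (@lebesgue_measure R).-integrable setT (fun x : R => (hermite q x * gdens x)%:E).
Proof.
have [C C0 H] := hermite_gdens_bound q.
apply: (le_integrable _ _ _ (integrableZl measurableT C (integrable_normal_pdf 0 2))) => //.
- by apply/measurable_EFinP; exact: measurable_hermite_gdens.
- move=> x _; rewrite -EFinM !abse_EFin lee_fin.
  by rewrite (le_trans (H x))// ler_norm.
Qed.

Lemma cvg_hermite_gdens q u :
  hermite q (u + n.+1%:R) * gdens (u + n.+1%:R) @[n --> \oo] --> (0 : R).
Proof.
have [C C0 H] := hermite_bound q (ltac:(by rewrite invr_gt0) : 0 < 4^-1 :> R).
have s0 : 0 < Num.sqrt (pi *+ 2) :> R by rewrite sqrtr_gt0 pmulrn_lgt0// pi_gt0.
(* With [x = u + n + 1], one has [(8 + 2 u^2) (1 + x^2 / 4) >= 2 x^2 + 2 u^2 + 8 >= n + 1], and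
   [1 + x^2 / 4 <= exp (x^2 / 4)]. *)
pose K := C / Num.sqrt (pi *+ 2) * (8 + 2 * u ^+ 2).
have bd n : `|hermite q (u + n.+1%:R) * gdens (u + n.+1%:R)| <= K * harmonic n.
  set x := u + _; rewrite normrM (ger0_norm (ltW (gdens_gt0 _))).
  apply: (@le_trans _ _ (C * expR (4^-1 * x ^+ 2) * gdens x)).
    by rewrite ler_pM2r ?gdens_gt0.
  rewrite /gdens.
  have -> : C * expR (4^-1 * x ^+ 2) * (expR (- x ^+ 2 / 2) / Num.sqrt (pi *+ 2))
    = C / Num.sqrt (pi *+ 2) * (expR (4^-1 * x ^+ 2) * expR (- x ^+ 2 / 2)).
    by field; rewrite gt_eqF.
  rewrite /K -[leRHS]mulrA ler_pM2l ?divr_gt0// -expRD.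
  have -> : 4^-1 * x ^+ 2 + - x ^+ 2 / 2 = - (x ^+ 2 / 4) by field.
  rewrite expRN /= -[leRHS]invrK lef_pV2 ?posrE ?expR_gt0//; last first.
    by rewrite invr_gt0 divr_gt0// ltr_wpDr// mulr_ge0// sqr_ge0.
  apply: (le_trans _ (expR_ge1Dx _)).
  have B0 : 0 < 8 + 2 * u ^+ 2 by have := sqr_ge0 u; lra.
  rewrite invfM invrK mulrC ler_pdivrMr//.
  rewrite {}/x -natr1; have : 0 <= n%:R :> R by [].
  move: (n%:R) => m m0.
  have := sqr_ge0 u; have := sqr_ge0 (u + (m + 1)); have := sqr_ge0 (2 * u + (m + 1)).
  by nra.
apply/norm_cvg0P.
apply: (@squeeze_cvgr _ _ _ _ (fun=> 0) (fun n => K * harmonic n)).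
- by near=> n; rewrite normr_ge0 bd.
- exact: cvg_cst.
- by rewrite -(mulr0 K); apply: cvgMr; exact: cvg_harmonic.
Unshelve. all: by end_near. Qed.

End Hermite.

Section hcoef.
Variable R : realType.
Implicit Types (q : nat) (u : R).

Lemma integral_hermite_gdens_itv q (a b : R) : a < b ->
  (\int[lebesgue_measure]_(x in `[a, b]) (hermite q.+1 x * gdens x)%:E =
   (hermite q a * gdens a - hermite q b * gdens b)%:E)%E.
Proof.
move=> ab; pose F (y : R) := - (hermite q y * gdens y) : R.
have dF x : derivable F x 1 by case: (is_derive_hermite_gdens q x).
have cF : continuous F.
  by move=> x; apply: differentiable_continuous; exact/derivable1_diffP.
rewrite (@continuous_FTC2 _ _ F)//.
- by rewrite /F -EFinB; congr EFin; ring.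
- by apply: continuous_subspaceT; exact: continuous_hermite_gdens.
- split=> //.
  + by apply: cvg_at_right_filter; exact: cF.
  + by apply: cvg_at_left_filter; exact: cF.
- by move=> x _; rewrite derive1E; case: (is_derive_hermite_gdens q x).
Qed.

Lemma integral_hermite_gdens_tail q u :
  (\int[lebesgue_measure]_x (hermite q.+1 x * ind_ge u x * gdens x)%:E =
   (hermite q u * gdens u)%:E)%E.
Proof.
set g := fun x : R => (hermite q.+1 x * gdens x)%:E.
(* Compact intervals exhaust the half-line; [n.+1] keeps them nondegenerate, as the formula on
   intervals asks for [a < b]. *)
pose f_ n := g \_ `[u, u + n.+1%:R].
have mg : measurable_fun setT g.
  by apply/measurable_EFinP; exact: measurable_hermite_gdens.
have lim1 : (\int[lebesgue_measure]_x f_ n x)%E @[n --> \oo] -->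
    (\int[lebesgue_measure]_x (hermite q.+1 x * ind_ge u x * gdens x)%:E)%E.
  apply: (@dominated_cvg _ _ _ lebesgue_measure setT measurableT f_
    (fun x => (hermite q.+1 x * ind_ge u x * gdens x)%:E) (abse \o g)) => //.
  - move=> n; apply/(measurable_restrictT g) => //.
    exact: measurable_funS mg.
  - move=> x _; rewrite /f_ /patch.
    have [xu|xu] := ltP x u.
      rewrite /ind_ge leNgt xu mulr0 mul0r.
      apply: cvg_near_cst; near=> n.
      by rewrite memNset//= in_itv/= leNgt xu.
    rewrite /ind_ge xu mulr1; apply: cvg_near_cst; near=> n.
    rewrite mem_set//= in_itv/= xu /=.
    rewrite -lerBlDl (@le_trans _ _ n%:R)//; last by rewrite ler_nat.
    by near: n; exact: nbhs_infty_ger.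
  - exact/integrable_abse/integrable_hermite_gdens.
  - move=> n x _; rewrite /f_ /patch; case: ifP => // _.
    by rewrite abse0 abse_ge0.
have lim2 : (\int[lebesgue_measure]_x f_ n x)%E @[n --> \oo] -->
    (hermite q u * gdens u)%:E.
  have -> : (fun n => \int[lebesgue_measure]_x f_ n x)%E = EFin \o
      (fun n => hermite q u * gdens u - hermite q (u + n.+1%:R) * gdens (u + n.+1%:R)).
    apply/funext => n; rewrite /f_ -integral_mkcond /= integral_hermite_gdens_itv//.
    by rewrite ltrDl.
  apply: cvg_EFin; first exact: nearW.
  rewrite -[X in _ --> X]subr0; apply: cvgB; first exact: cvg_cst.
  exact: cvg_hermite_gdens.
exact: (cvg_unique _ lim1 lim2).
Unshelve. all: by end_near. Qed.

Lemma hcoef_ind_ge q u :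
  hcoef (ind_ge u) q.+1 = hermite q u * gdens u / q.+1`!%:R.
Proof.
by rewrite /hcoef /Rintegral integral_hermite_gdens_tail /= mulrC.
Qed.

End hcoef.

(** * Size of Hermite polynomials at a fixed point *)

Section HermiteAsymptotics.
Variables (R : realType) (u : R).

Let k : R := `|u| / 2.

Definition hermite_sq n : R := hermite n u ^+ 2 / n`!%:R.

(* The three-term recurrence makes [T_(n+1) - T_n] exactly one square, whereas
   [T_n] is [n+1] times the sum of two consecutive ones up to a relative error
   [O(n^{-1/2})]. *)
Definition hermite_turan n : R :=
  (hermite n.+1 u ^+ 2 + n.+1%:R * hermite n u ^+ 2
   - u * hermite n.+1 u * hermite n u) / n`!%:R.

Local Notation hsq := hermite_sq.
Local Notation T := hermite_turan.
Local Notation E n := (hsq n + hsq n.+1).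
Local Notation s n := (Num.sqrt n.+1%:R : R).

Let k0 : 0 <= k. Proof. by rewrite divr_ge0. Qed.
Let fact0 n : 0 < n`!%:R :> R. Proof. by rewrite ltr0n fact_gt0. Qed.
Let sgt0 n : 0 < s n. Proof. by rewrite sqrtr_gt0. Qed.
Let ssq n : s n ^+ 2 = n.+1%:R. Proof. by rewrite sqr_sqrtr. Qed.

Lemma hermite_sq_ge0 n : 0 <= hsq n.
Proof. by rewrite divr_ge0 ?sqr_ge0. Qed.

Lemma hermite_turanS n : T n.+1 = T n + hsq n.+1.
Proof.
rewrite /T /hsq hermiteSS factS natrM.
have f0 := fact0 n; field.
by rewrite gt_eqF//= -natr1 gt_eqF// ltr_wpDl.
Qed.

(** The cross term [u H_n H_(n+1)] is split by [2 a b <= a^2 + b^2] applied to [H_n] and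
    [H_(n+1) / s n], the weights that occur in the pair of squares. *)
Lemma hermite_turan_near n :
  `|T n - s n ^+ 2 * E n| <= k * s n * E n.
Proof.
rewrite ssq.
have f0 := fact0 n; have s0 := sgt0 n.
have n0 : 0 < n.+1%:R :> R by [].
have -> : T n - n.+1%:R * E n = - (u * (hermite n.+1 u * hermite n u)) / n`!%:R.
  rewrite /T /hsq factS natrM; field.
  by rewrite gt_eqF//= -natr1 gt_eqF// ltr_wpDl.
have -> : E n = (hermite n u ^+ 2 + (hermite n.+1 u / s n) ^+ 2) / n`!%:R.
  rewrite expr_div_n ssq /hsq factS natrM; field.
  by rewrite gt_eqF//= -natr1 gt_eqF// ltr_wpDl.
rewrite normrM normfV (gtr0_norm f0) [leRHS]mulrA ler_pM2r ?invr_gt0//.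
rewrite normrN !normrM -(real_normK (num_real (hermite n u))) -(real_normK (num_real (_ / s n))).
rewrite normf_div (gtr0_norm s0).
set a := `|hermite n.+1 u|; set b := `|hermite n u|.
have -> : `|u| * (a * b) = k * s n * (2 * (b * (a / s n))).
  by rewrite /k; field; rewrite gt_eqF.
rewrite ler_wpM2l ?mulr_ge0//.
by have := sqr_ge0 (b - a / s n); nra.
Qed.

(** Two consecutive zeros would propagate down the recurrence to [H_0 = 1]. *)
Lemma hermite_sq_pair_gt0 n : 0 < E n.
Proof.
rewrite lt0r addr_ge0 ?hermite_sq_ge0// andbT; apply/eqP => E0.
have : hsq n = 0 /\ hsq n.+1 = 0.
  by have := hermite_sq_ge0 n; have := hermite_sq_ge0 n.+1; split; lra.
have z m : hsq m = 0 -> hermite m u = 0.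
  move=> /eqP; rewrite mulf_eq0 invr_eq0 (gt_eqF (fact0 m)) orbF sqrf_eq0.
  by move=> /eqP.
move=> [/z h0 /z h1]; elim: n h0 h1 {E0} => [|n IH].
  by move=> /eqP; rewrite hermite0 oner_eq0.
move=> h1; rewrite hermiteSS h1 mulr0 sub0r => /eqP.
by rewrite oppr_eq0 mulf_eq0 pnatr_eq0 /= => /eqP /IH; exact.
Qed.

Lemma sqrt_succ_sub n : 0 <= s n.+1 - s n <= (2 * s n)^-1.
Proof.
have h : s n.+1 ^+ 2 = s n ^+ 2 + 1 by rewrite !ssq [RHS]natr1.
have h0 := sgt0 n; have h1 := sgt0 n.+1.
have h2 : s n <= s n.+1 by nra.
rewrite subr_ge0 h2 /= -[leRHS]div1r ler_pdivlMr ?mulr_gt0//.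
by nra.
Qed.

(** As the root of [n] grows by about [1 / (2 sqrt n)] per step, both step inequalities below amount
    to [K / 2 >= k] at leading order; the extra 2 pays for the remaining terms. [M] is large enough
    to give both bounds of [sM]. *)
Let K : R := 2 * k + 2.
Let M : R := k ^+ 2 + 3 * k + 3.

Section Large.
Variables (n : nat) (Mn : M <= s n.+1).

Let sM : 2 * k + 3 <= s n.+1 /\ k * (k + 1) <= s n.+1.
Proof. by move: Mn (k0) (sqr_ge0 k); rewrite /M => h h1 h2; split; lra. Qed.

(* Passing to the products [T_n T_(n+1)] turns the increment into a sum of two
   consecutive squares, i.e. into [T] itself: the products grow linearly. They
   are compared with [n - K sqrt n] from above and [n + K sqrt n] from below. *)
Lemma hermite_turan_prod_le : 0 < T n ->
  T n.+1 * T n.+2 <=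
  T n * T n.+1 * (1 + (s n.+1 ^+ 2 - 1 - k * s n.+1)^-1).
Proof.
move=> T0; have [s1 _] := sM; have kk := k0.
have D0 : 0 < s n.+1 ^+ 2 - 1 - k * s n.+1 by nra.
have T1 : 0 < T n.+1 by rewrite hermite_turanS; have := hermite_sq_ge0 n.+1; lra.
have E0 := hermite_sq_pair_gt0 n.+1.
have := hermite_turan_near n.+1; rewrite ler_norml => /andP[lo hi].
have -> : T n.+2 = T n + E n.+1 by rewrite !hermite_turanS; ring.
suff h : E n.+1 <= T n / (s n.+1 ^+ 2 - 1 - k * s n.+1).
  have := ler_wpM2l (ltW T1) h; move: (_ - _ - _)^-1 => D; lra.
rewrite ler_pdivlMr//.
have e : T n = T n.+1 - hsq n.+1 by rewrite hermite_turanS; ring.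
rewrite e; have := hermite_sq_ge0 n.+2; lra.
Qed.

Lemma hermite_turan_prod_ge : 0 < T n ->
  T n * T n.+1 * (1 + (s n.+1 ^+ 2 + k * s n.+1)^-1) <= T n.+1 * T n.+2.
Proof.
move=> T0; have [s1 _] := sM; have kk := k0.
have D0 : 0 < s n.+1 ^+ 2 + k * s n.+1 by nra.
have T1 : T n <= T n.+1 by rewrite hermite_turanS; have := hermite_sq_ge0 n.+1; lra.
have E0 := hermite_sq_pair_gt0 n.+1.
have := hermite_turan_near n.+1; rewrite ler_norml => /andP[lo hi].
have -> : T n.+2 = T n + E n.+1 by rewrite !hermite_turanS; ring.
suff h : T n / (s n.+1 ^+ 2 + k * s n.+1) <= E n.+1.
  have := ler_wpM2l (le_trans (ltW T0) T1) h; move: (_ + k * _)^-1 => D; lra.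
rewrite ler_pdivrMr//; lra.
Qed.

(** A supersolution for [hermite_turan_prod_le]. For consecutive roots [x], [y], the bound
    [x (y - x) <= 1/2] gives [x K (y - x) <= k + 1], which stays below [K - k = k + 2]. *)
Lemma sqrt_step_upper :
  (s n.+1 ^+ 2 - K * s n.+1) * (1 + (s n.+1 ^+ 2 - 1 - k * s n.+1)^-1)
  <= s n.+2 ^+ 2 - K * s n.+2.
Proof.
have [s1 _] := sM; have kk := k0; have s0 := sgt0 n.+1.
have D0 : 0 < s n.+1 ^+ 2 - 1 - k * s n.+1 by nra.
have -> : s n.+2 ^+ 2 = s n.+1 ^+ 2 + 1 by rewrite !ssq [RHS]natr1.
have /andP[d0] := sqrt_succ_sub n.+1.
set x := s n.+1 in s1 s0 D0 d0 *; set y := s n.+2 in d0 *.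
rewrite -[leRHS]div1r ler_pdivlMr ?mulr_gt0// => d1.
rewrite mulrDr mulr1.
suff : (x ^+ 2 - K * x) / (x ^+ 2 - 1 - k * x) <= 1 - K * (y - x) by lra.
rewrite ler_pdivrMr//.
have d2 : x * (K * (y - x)) <= k + 1.
  have -> : x * (K * (y - x)) = (k + 1) * ((y - x) * (2 * x)) by rewrite /K; ring.
  by rewrite ler_piMr// addr_ge0.
suff : K * (y - x) * (x ^+ 2 - 1 - k * x) <= (K - k) * x - 1 by lra.
have -> : K * (y - x) * (x ^+ 2 - 1 - k * x)
  = x * (K * (y - x)) * (x - k) - K * (y - x) by ring.
have p1 : 0 <= K * (y - x) by rewrite mulr_ge0 ?subr_ge0// /K; lra.
have p2 : x * (K * (y - x)) * (x - k) <= (k + 1) * (x - k).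
  by rewrite ler_wpM2r//; lra.
have -> : K - k = k + 2 by rewrite /K; ring.
by have := sqr_ge0 k; lra.
Qed.

(** The matching subsolution; here the remainder [k (k + 1)] is absorbed by the spare [x], which is
    the second half of [sM]. *)
Lemma sqrt_step_lower :
  s n.+2 ^+ 2 + K * s n.+2 <=
  (s n.+1 ^+ 2 + K * s n.+1) * (1 + (s n.+1 ^+ 2 + k * s n.+1)^-1).
Proof.
have [s1 s2] := sM; have kk := k0; have s0 := sgt0 n.+1.
have D0 : 0 < s n.+1 ^+ 2 + k * s n.+1 by nra.
have -> : s n.+2 ^+ 2 = s n.+1 ^+ 2 + 1 by rewrite !ssq [RHS]natr1.
have /andP[d0] := sqrt_succ_sub n.+1.
set x := s n.+1 in s1 s2 s0 D0 d0 *; set y := s n.+2 in d0 *.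
rewrite -[leRHS]div1r ler_pdivlMr ?mulr_gt0// => d1.
rewrite [leRHS]mulrDr mulr1.
suff : 1 + K * (y - x) <= (x ^+ 2 + K * x) / (x ^+ 2 + k * x) by lra.
rewrite ler_pdivlMr//.
have d2 : x * (K * (y - x)) <= k + 1.
  have -> : x * (K * (y - x)) = (k + 1) * ((y - x) * (2 * x)) by rewrite /K; ring.
  by rewrite ler_piMr// addr_ge0.
have -> : (1 + K * (y - x)) * (x ^+ 2 + k * x)
  = x ^+ 2 + k * x + x * (K * (y - x)) * (x + k) by ring.
have p2 : x * (K * (y - x)) * (x + k) <= (k + 1) * (x + k).
  by rewrite ler_wpM2r//; lra.
have e : K * x = 2 * (k * x) + 2 * x by rewrite /K; ring.
by lra.
Qed.

End Large.

(** As [T] is monotone, [T n ^+ 2 <= T n * T n.+1 <= T n.+1 ^+ 2]: linear growth of the products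
    forces [T n] to be of order [sqrt n], and dividing by [n] gives the pair of squares. *)
Lemma hermite_pair_asymp : exists c C (n0 : nat),
  [/\ 0 < c, 0 < C & forall n, (n0 <= n)%N ->
     hsq n <= C / s n /\ c / s n <= E n].
Proof.
have kk := k0.
have M0 : 0 < M by rewrite /M; have := sqr_ge0 k; lra.
have [n0 n0M] : exists n0 : nat, M ^+ 2 <= n0%:R.
  exists (Num.bound (M ^+ 2)).
  by apply/ltW; apply: le_lt_trans (archi_boundP (sqr_ge0 _)); rewrite ?ler_norm.
have MsW n : (n0 <= n)%N -> M <= s n.
  move=> n0n; rewrite -(@ler_pXn2r _ 2)// ?nnegrE; [|exact: ltW|exact: ltW (sgt0 _)].
  rewrite ssq (le_trans n0M)// ler_nat; exact: leqW.
have bnds n : (n0 <= n)%N -> 2 * k + 3 <= s n.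
  by move=> /MsW; rewrite /M; have := sqr_ge0 k; lra.
have Tlo n : (n0 <= n)%N -> s n ^+ 2 / 2 * E n <= T n.
  move=> /bnds b; have E0 := hermite_sq_pair_gt0 n.
  have := hermite_turan_near n; rewrite ler_norml => /andP[lo _].
  have h : 0 <= (s n ^+ 2 / 2 - k * s n) * E n.
    by rewrite mulr_ge0 ?(ltW E0)//; move: (s n) b => x b; nra.
  by lra.
have Thi n : (n0 <= n)%N -> T n <= 2 * s n ^+ 2 * E n.
  move=> /bnds b; have E0 := hermite_sq_pair_gt0 n.
  have := hermite_turan_near n; rewrite ler_norml => /andP[_ hi].
  have h : 0 <= (s n ^+ 2 - k * s n) * E n.
    by rewrite mulr_ge0 ?(ltW E0)//; move: (s n) b => x b; nra.
  by lra.
have T0 n : (n0 <= n)%N -> 0 < T n.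
  move=> n0n; apply: lt_le_trans (Tlo _ n0n).
  by rewrite mulr_gt0 ?hermite_sq_pair_gt0// divr_gt0// exprn_gt0.
have Tmono n : T n <= T n.+1 by rewrite hermite_turanS lerDl hermite_sq_ge0.
pose bu n := s n.+1 ^+ 2 - K * s n.+1; pose bl n := s n.+1 ^+ 2 + K * s n.+1.
have bu0 n : (n0 <= n)%N -> 0 < bu n.
  move=> n0n; have := bnds n.+1 (leqW n0n); rewrite /bu /K.
  by move: (s n.+1) => x b; nra.
have bl0 n : 0 < bl n.
  by rewrite addr_gt0// ?exprn_gt0// mulr_gt0// /K; lra.
pose a := T n0 * T n0.+1 / bl n0; pose A := T n0 * T n0.+1 / bu n0.
have PP : 0 < T n0 * T n0.+1 by rewrite mulr_gt0// T0.
have a0 : 0 < a by rewrite divr_gt0.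
have A0 : 0 < A by rewrite divr_gt0// bu0.
have Phi n : (n0 <= n)%N -> T n * T n.+1 <= A * bu n.
  elim: n => [|n IH]; first by rewrite leqn0 => /eqP e; rewrite /A e divfK// gt_eqF// -e bu0// e.
  rewrite leq_eqVlt => /predU1P[<-|]; first by rewrite /A divfK// gt_eqF// bu0.
  rewrite ltnS => n0n; have Mn := MsW n.+1 (leqW n0n).
  apply: (le_trans (hermite_turan_prod_le Mn (T0 _ n0n))).
  apply: le_trans (ler_wpM2l (ltW A0) (sqrt_step_upper Mn)).
  rewrite [leRHS]mulrA ler_wpM2r ?IH// addr_ge0// invr_ge0.
  by have := bnds n.+1 (leqW n0n); move: (s n.+1) => x b; nra.
have Plo n : (n0 <= n)%N -> a * bl n <= T n * T n.+1.
  elim: n => [|n IH]; first by rewrite leqn0 => /eqP e; rewrite /a e divfK// gt_eqF.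
  rewrite leq_eqVlt => /predU1P[<-|]; first by rewrite /a divfK// gt_eqF.
  rewrite ltnS => n0n; have Mn := MsW n.+1 (leqW n0n).
  apply: le_trans (hermite_turan_prod_ge Mn (T0 _ n0n)).
  apply: (le_trans (ler_wpM2l (ltW a0) (sqrt_step_lower Mn))).
  rewrite [leLHS]mulrA ler_wpM2r ?IH// addr_ge0// invr_ge0.
  by rewrite addr_ge0 ?sqr_ge0// mulr_ge0// ltW.
have sqle (x y : R) : 0 <= x -> 0 <= y -> x ^+ 2 <= y ^+ 2 -> x <= y.
  by move=> x0 y0; rewrite ler_pXn2r.
have TA n : (n0 <= n)%N -> T n <= Num.sqrt A * s n.+1.
  move=> n0n; have Tn0 := T0 _ n0n.
  apply: sqle; [exact: ltW|by rewrite mulr_ge0 ?sqrtr_ge0|].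
  rewrite (exprMn _ (Num.sqrt A)) sqr_sqrtr ?(ltW A0)//.
  apply: (@le_trans _ _ (T n * T n.+1)); first by rewrite expr2 ler_wpM2l// ltW.
  apply: (le_trans (Phi _ n0n)); rewrite ler_wpM2l ?(ltW A0)// /bu gerBl.
  by rewrite mulr_ge0 ?sqrtr_ge0// /K; lra.
have Ta n : (n0 <= n)%N -> Num.sqrt a * s n.+1 <= T n.+1.
  move=> n0n; have Tn0 := T0 _ n0n; have Tn1 := T0 _ (leqW n0n).
  apply: sqle; [by rewrite mulr_ge0 ?sqrtr_ge0|exact: ltW|].
  rewrite (exprMn _ (Num.sqrt a)) sqr_sqrtr ?(ltW a0)//.
  apply: (@le_trans _ _ (T n * T n.+1)); last by rewrite expr2 ler_wpM2r// ltW.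
  apply: le_trans (Plo _ n0n); rewrite ler_wpM2l ?(ltW a0)// /bl lerDl.
  by rewrite mulr_ge0 ?sqrtr_ge0// /K; lra.
have sA : 0 < Num.sqrt A by rewrite sqrtr_gt0.
have sa : 0 < Num.sqrt a by rewrite sqrtr_gt0.
(* The factor 1/2 comes from [Thi]; the 4 is the 2 of [Tlo] times the 2 of [s n.+2 <= 2 * s n.+1].
   The index starts at [n0.+1] because [Ta] bounds [T n.+1]. *)
exists (Num.sqrt a / 2), (4 * Num.sqrt A), n0.+1; split; rewrite ?divr_gt0 ?mulr_gt0//.
case=> // n n0n; rewrite ltnS in n0n; split; last first.
  have h := le_trans (Ta _ n0n) (Thi _ (leqW n0n)); have s0 := sgt0 n.+1.
  rewrite ler_pdivrMr// ler_pdivrMr//.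
  rewrite expr2 !mulrA [leRHS]mulrAC in h; rewrite ler_pM2r// in h; lra.
have s0 := sgt0 n.+1; have n1 := leqW n0n.
have h := le_trans (Tlo _ n1) (TA _ n1).
have ss : s n.+2 <= 2 * s n.+1.
  rewrite -(@ler_pXn2r _ 2) ?nnegrE ?mulr_ge0 ?sqrtr_ge0//.
  by rewrite exprMn !ssq -natrX -natrM ler_nat; lia.
have h2 : s n.+1 ^+ 2 / 2 * hsq n.+1 <= Num.sqrt A * (2 * s n.+1).
  apply: (@le_trans _ _ (s n.+1 ^+ 2 / 2 * E n.+1)).
    by rewrite ler_wpM2l ?divr_ge0 ?sqr_ge0// lerDl hermite_sq_ge0.
  by apply: (le_trans h); rewrite ler_wpM2l// ltW.
rewrite ler_pdivlMr// -(ler_pM2r s0); move: h2; move: (s n.+1) (hsq n.+1) => x y; lra.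
Qed.

End HermiteAsymptotics.

(** * Iterated integrals and cubes *)

Section Monotone.
Local Open Scope ereal_scope.

(* The integral is defined for all functions, as the difference of two
   suprema over simple functions; hence no measurability is needed here. *)
Lemma le_integral_nomeas d (T : measurableType d) (R : realType)
    (mu : {measure set T -> \bar R}) (f g : T -> \bar R) :
  (forall x, f x <= g x) -> \int[mu]_x f x <= \int[mu]_x g x.
Proof.
have le0 (h1 h2 : T -> \bar R) : (forall x, 0 <= h1 x) ->
    (forall x, h1 x <= h2 x) -> \int[mu]_x h1 x <= \int[mu]_x h2 x.
  move=> h0 h12; rewrite !ge0_integralTE//; last first.
    by move=> x; exact: le_trans (h12 x).
  apply: le_ereal_sup => _ [h /= hh <-]; exists h => //= x.
  exact: le_trans (h12 x).
move=> fg; rewrite integralE [leRHS]integralE; apply: leeB.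
- apply: le0 => x; first exact: funepos_ge0.
  by apply: (@funepos_le _ _ setT) => [y _|]; rewrite ?inE.
- apply: le0 => x; first exact: funeneg_ge0.
  by apply: (@funeneg_le _ _ setT) => [y _|]; rewrite ?inE.
Qed.

Variable R : realType.

Lemma le_leb_int m (f g : 'rV[R]_m.+1 -> \bar R) :
  (forall x, f x <= g x) -> leb_int f <= leb_int g.
Proof.
move=> fg; suff H k x : iint k f x <= iint k g x by exact: H.
elim: k x => [|k IH] x /=; first exact: fg.
by apply: le_integral_nomeas => t; exact: IH.
Qed.

End Monotone.

Section Boxes.
Variable R : realType.

(* A triple [(w, c, h)] stands for [w] times the indicator of the cube of centre
   [c] and half side [h]. *)
Definition in_box m (c : 'rV[R]_m) (h : R) (y : 'rV[R]_m) : bool :=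
  [forall i, `|y ord0 i - c ord0 i| <= h].

Definition box_sum m (s : seq (R * 'rV[R]_m * R)) (y : 'rV[R]_m) : R :=
  \sum_(b <- s) b.1.1 * (in_box b.1.2 b.2 y)%:R.

Definition box_mass m (s : seq (R * 'rV[R]_m * R)) : R :=
  \sum_(b <- s) b.1.1 * (2 * b.2) ^+ m.

Lemma integral_itv_sum (I : eqType) (s : seq I) (a c h : I -> R) :
  {in s, forall b, 0 <= h b} ->
  (\int[@lebesgue_measure R]_t
     (\sum_(b <- s) a b * (`|t - c b| <= h b)%R%:R)%:E
   = (\sum_(b <- s) a b * (2 * h b))%:E)%E.
Proof.
pose J b : set R := `[c b - h b, c b + h b]%classic.
have JE b t : ((`|t - c b| <= h b)%R%:R : R) = \1_(J b) t.
  rewrite indicE; congr (nat_of_bool _)%:R.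
  by apply/idP/idP; rewrite ?inE /J /= in_itv /= ler_distl.
have intJ b : (@lebesgue_measure R).-integrable setT (fun t => (a b)%:E * (\1_(J b) t)%:E)%E.
  by apply: integrableZl => //; exact: integrable_indic_itv.
move=> h0.
transitivity (\int[@lebesgue_measure R]_t (\sum_(b <- s) (a b)%:E * (\1_(J b) t)%:E))%E.
  apply: eq_integral => t _; rewrite -sumEFin; apply: eq_bigr => b _.
  by rewrite JE EFinM.
rewrite integral_sum// -sumEFin; apply: eq_big_seq => b bs.
rewrite integralZl//; last exact: integrable_indic_itv.
rewrite integral_indic //; last exact: measurable_itv.
rewrite setIT /J /= lebesgue_measure_itv /= lte_fin.
have := h0 _ bs; rewrite le_eqVlt => /predU1P[<-|hb].
  by rewrite subr0 addr0 ltxx !mulr0 mule0.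
by rewrite ltrD2l gtrN// -EFinD -EFinM; congr EFin; ring.
Qed.

Lemma leb_int_box_sum m (s : seq (R * 'rV[R]_m.+1 * R)) :
  {in s, forall b, 0 <= b.2} ->
  leb_int (fun y => (box_sum s y)%:E) = (box_mass s)%:E.
Proof.
move=> s0.
(* After [k] integrations the first [k] coordinates have become side lengths, and the others are
   still frozen at those of [x]. *)
suff H k x : (k <= m.+1)%N -> iint k (fun y => (box_sum s y)%:E) x =
   (\sum_(b <- s) b.1.1 * (2 * b.2) ^+ k *
      \prod_(i < m.+1 | (k <= i)%N) (`|x ord0 i - b.1.2 ord0 i| <= b.2)%R%:R)%:E.
  rewrite /leb_int H//; congr EFin; apply: eq_bigr => b _.
  by rewrite big_pred0 ?mulr1// => i; rewrite leqNgt ltn_ord.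
elim: k x => [|k IH] x km /=.
  congr EFin; apply: eq_bigr => b _; rewrite expr0 mulr1; congr (_ * _).
  rewrite /in_box; case: forallP => [h|h].
    by rewrite big1// => i _; rewrite h.
  case/existsNP: h => i /negP/negbTE hi.
  by rewrite (bigD1 i)//= hi mul0r.
have ik : (inord k : 'I_m.+1) = k :> nat by rewrite inordK.
transitivity (\int[@lebesgue_measure R]_t (\sum_(b <- s) (b.1.1 * (2 * b.2) ^+ k *
    \prod_(i < m.+1 | (k < i)%N) (`|x ord0 i - b.1.2 ord0 i| <= b.2)%R%:R)
    * (`|t - b.1.2 ord0 (inord k)| <= b.2)%R%:R)%:E)%E.
  apply: eq_integral => t _; rewrite IH 1?ltnW//; congr EFin.
  apply: eq_bigr => b _; rewrite -[RHS]mulrA; congr (_ * _).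
  rewrite (bigD1 (inord k)) ?ik//= !mxE eqxx mulrC; congr (_ * _).
  apply: eq_big => [i|i /andP[_ /negbTE ne]]; last by rewrite mxE ne.
  by rewrite ltn_neqAle andbC eq_sym -(inj_eq val_inj) /= ik.
rewrite integral_itv_sum//; congr EFin; apply: eq_bigr => b _.
by rewrite exprSr; ring.
Qed.

End Boxes.

(** * Cubes along a ray, as bounds for functions on the sphere *)

Section Covers.
Variables (R : realType) (d : nat).
Implicit Types (x y : 'rV[R]_d.+1) (r w : R).

Lemma enorm_ge0 x : 0 <= enorm x.
Proof. exact: sqrtr_ge0. Qed.

Lemma dotvv_ge0 x : 0 <= dotv x x.
Proof. by apply: sumr_ge0 => i _; rewrite -expr2 sqr_ge0. Qed.

Lemma enorm_sqr x : enorm x ^+ 2 = dotv x x.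
Proof. by rewrite sqr_sqrtr ?dotvv_ge0. Qed.

Lemma enorm_gt0 x : (0 < enorm x) = (x != 0).
Proof.
rewrite sqrtr_gt0 lt0r dotvv_ge0 andbT; congr (~~ _); apply/eqP/eqP => [|->].
  move=> /psumr_eq0P h; apply/rowP => i.
  have /eqP := h (fun i _ => sqr_ge0 (x ord0 i)) i isT.
  by rewrite mulf_eq0 orbb => /eqP; rewrite mxE.
by apply: big1 => i _; rewrite mxE mul0r.
Qed.

Lemma dotvC x y : dotv x y = dotv y x.
Proof. by apply: eq_bigr => i _; rewrite mulrC. Qed.

Lemma dotvZr (a : R) x y : dotv x (a *: y) = a * dotv x y.
Proof. by rewrite /dotv mulr_sumr; apply: eq_bigr => i _; rewrite mxE; ring. Qed.

Lemma dotvBB x y : dotv (x - y) (x - y) = dotv x x - 2 * dotv x y + dotv y y.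
Proof.
rewrite /dotv mulr_sumr -sumrB -big_split; apply: eq_bigr => i _.
by rewrite !mxE /=; ring.
Qed.

Lemma sphere_dotv x : sphere x -> dotv x x = 1.
Proof. by rewrite -enorm_sqr => ->; rewrite expr1n. Qed.

Lemma sphere_normalize x : x != 0 -> sphere ((enorm x)^-1 *: x).
Proof.
rewrite -enorm_gt0 => x0; rewrite /sphere /= {1}/enorm dotvZr dotvC dotvZr.
rewrite -enorm_sqr.
have -> : (enorm x)^-1 * ((enorm x)^-1 * enorm x ^+ 2) = 1.
  by field; rewrite gt_eqF.
by rewrite sqrtr1.
Qed.

Lemma sphere_dist x y : sphere x -> sphere y ->
  dotv (y - x) (y - x) = 2 - 2 * dotv x y.
Proof. by move=> /sphere_dotv hx /sphere_dotv hy; rewrite dotvBB hx hy dotvC; ring. Qed.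

Lemma sphere_dotv_bound x y : sphere x -> sphere y -> -1 <= dotv x y <= 1.
Proof.
move=> sx sy; apply/andP; split; last first.
  by have := dotvv_ge0 (y - x); rewrite sphere_dist//; lra.
have := dotvv_ge0 (x - (-1) *: y).
rewrite dotvBB dotvZr [dotv (_ *: _) _]dotvZr [dotv (_ *: _) _]dotvC dotvZr.
by rewrite (sphere_dotv sx) (sphere_dotv sy); lra.
Qed.

Lemma coord_le_dotv x i : x ord0 i ^+ 2 <= dotv x x.
Proof.
rewrite /dotv (bigD1 i)//= expr2 lerDl; apply: sumr_ge0 => j _.
by rewrite -expr2 sqr_ge0.
Qed.

Lemma dotv_le_box x (h : R) : 0 <= h -> (forall i, `|x ord0 i| <= h) ->
  dotv x x <= d.+1%:R * h ^+ 2.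
Proof.
move=> h0 hx.
have -> : d.+1%:R * h ^+ 2 = \sum_(i < d.+1) h ^+ 2.
  by rewrite sumr_const card_ord mulr_natl.
apply: ler_sum => i _; rewrite -expr2 -(real_normK (num_real _)).
by rewrite ler_pXn2r ?nnegrE.
Qed.

Lemma sum_inv_sqr_le2 n : \sum_(k < n) (k.+1%:R ^+ 2)^-1 <= 2 :> R.
Proof.
case: n => [|n]; first by rewrite big_ord0.
suff : \sum_(k < n.+1) (k.+1%:R ^+ 2)^-1 <= 2 - (n.+1%:R)^-1 :> R.
  by move/le_trans; apply; rewrite gerBl.
elim: n => [|n IH]; first by rewrite big_ord_recr big_ord0 /= expr1n invr1; lra.
rewrite big_ord_recr /=; apply: (le_trans (lerD IH (lexx _))).
rewrite -[n.+2%:R]natr1; have : 0 < n.+1%:R :> R by [].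
move: (n.+1%:R) => m m0.
have m1 : 0 < m + 1 by rewrite addr_gt0.
suff : 0 <= m^-1 - (m + 1)^-1 - ((m + 1) ^+ 2)^-1 by lra.
have -> : m^-1 - (m + 1)^-1 - ((m + 1) ^+ 2)^-1 = (m * (m + 1) ^+ 2)^-1.
  by field; rewrite !gt_eqF.
by rewrite invr_ge0 mulr_ge0 ?sqr_ge0// ltW.
Qed.

(* Cubes indexed by [k] and [j]: [k] is the distance from [y/|y|] to [x] in units
   of [r], and [j] is [|y|] in units of [(k+1) r], so that the cubes with fixed [k]
   follow the ray through [x]. *)
Lemma box_cover_upper x r : sphere x -> 0 < r -> r <= 1 ->
  exists s : seq (R * 'rV[R]_d.+1 * R),
  [/\ {in s, forall b, 0 <= b.2}, box_mass s <= 4 ^+ d.+2 * r ^+ d,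
      forall y, 0 <= box_sum s y &
      forall y, y != 0 -> enorm y <= 1 ->
        ((1 + Num.sqrt (2 - 2 * dotv x ((enorm y)^-1 *: y)) / r) ^+ d.+3)^-1
        <= box_sum s y].
Proof.
move=> sx r0 r1.
(* Chords of the sphere are at most 2 and norms at most 1; [J] is the count for the finest spacing,
   [k = 0]. *)
pose K := (Num.truncn (2 / r)).+1; pose J := (Num.truncn (1 / r)).+1.
(* The weight decays by two powers more than the volume [(k+1)^(d+1)] grows, so the sum over [k] is
   bounded uniformly in [r]. *)
pose bx (k j : nat) : R * 'rV[R]_d.+1 * R :=
  ((k.+1%:R ^+ d.+3)^-1, (j%:R * (k.+1%:R * r)) *: x, 2 * (k.+1%:R * r)).
pose s := [seq bx k j | k <- iota 0 K, j <- iota 0 J].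
have kr0 k : 0 < k.+1%:R * r by rewrite mulr_gt0.
have sumE (F : R * 'rV[R]_d.+1 * R -> R) :
    \sum_(b <- s) F b = \sum_(k < K) \sum_(j < J) F (bx k j).
  rewrite /s big_allpairs_dep.
  rewrite -[iota 0 K]/(index_iota 0 K) big_mkord; apply: eq_bigr => k _.
  by rewrite -[iota 0 J]/(index_iota 0 J) big_mkord.
have w0 k : 0 <= (k.+1%:R ^+ d.+3)^-1 :> R by rewrite invr_ge0 exprn_ge0.
exists s; split.
- by move=> b /allpairsP[[k j] [_ _ ->]] /=; rewrite mulr_ge0// ltW.
- rewrite /box_mass sumE /=.
  have -> : \sum_(k < K) \sum_(j < J) (k.+1%:R ^+ d.+3)^-1 * (2 * (2 * (k.+1%:R * r))) ^+ d.+1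
      = (J%:R * (4 * r) ^+ d.+1) * \sum_(k < K) (k.+1%:R ^+ 2)^-1 :> R.
    rewrite mulr_sumr; apply: eq_bigr => k _.
    rewrite sumr_const card_ord -[LHS]mulr_natl.
    have k0 : k.+1%:R != 0 :> R by [].
    have -> : 2 * (2 * (k.+1%:R * r)) = k.+1%:R * (4 * r) by ring.
    move: (k.+1%:R) k0 => m m0; rewrite exprMn !exprS; field.
    by rewrite ?m0 ?expf_neq0.
  apply: (@le_trans _ _ (2 / r * (4 * r) ^+ d.+1 * 2)).
    apply: ler_pM; rewrite ?mulr_ge0 ?exprn_ge0 ?mulr_ge0 ?(ltW r0)//.
    + by apply: sumr_ge0 => k _; rewrite invr_ge0 exprn_ge0.
    + rewrite ler_wpM2r ?exprn_ge0 ?mulr_ge0 ?(ltW r0)//.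
      rewrite /J -natr1; have h : 1 <= 1 / r by rewrite ler_pdivlMr// mul1r.
      have h2 : 0 <= 1 / r by lra.
      by have /andP[h3 _] := truncn_itv h2; lra.
    + exact: sum_inv_sqr_le2.
  rewrite exprMn !exprS le_eqVlt; apply/orP; left; apply/eqP.
  by field; rewrite gt_eqF.
- move=> y; rewrite /box_sum sumE.
  by apply: sumr_ge0 => k _; apply: sumr_ge0 => j _; apply: mulr_ge0 => //; exact: w0.
- move=> y y0 y1.
  set yh := _ *: y; have syh : sphere yh by exact: sphere_normalize.
  rewrite -sphere_dist// -/(enorm _).
  set e := enorm (yh - x); have e0 : 0 <= e by exact: enorm_ge0.
  have N0 : 0 < enorm y by rewrite enorm_gt0.
  have e2 : e <= 2.
    rewrite -(@ler_pXn2r _ 2) ?nnegrE// enorm_sqr sphere_dist//.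
    by have /andP[] := sphere_dotv_bound sx syh; lra.
  have er0 : 0 <= e / r by rewrite divr_ge0// ltW.
  have /andP[k1 k2] := truncn_itv er0; set k := Num.truncn _ in k1 k2.
  have kK : (k < K)%N.
    by rewrite ltnS /k; apply: le_truncn; rewrite ler_wpM2r// invr_ge0 ltW.
  have Nk0 : 0 <= enorm y / (k.+1%:R * r) by rewrite divr_ge0// ltW.
  have /andP[j1 j2] := truncn_itv Nk0; set j := Num.truncn _ in j1 j2.
  have jJ : (j < J)%N.
    rewrite ltnS /j; apply: le_truncn.
    apply: ler_pM => //; [exact: ltW|by rewrite invr_ge0 ltW|].
    by rewrite lef_pV2 ?posrE// ler_peMl ?(ltW r0)// ler1n.
  rewrite /box_sum sumE (bigD1 (Ordinal kK))//= (bigD1 (Ordinal jJ))//=.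
  rewrite -addrA ler_wpDr//.
    apply: addr_ge0; apply: sumr_ge0 => i _.
      by apply: mulr_ge0 => //; exact: w0.
    by apply: sumr_ge0 => i' _; apply: mulr_ge0 => //; exact: w0.
  (* The deviation from the centre has a part from the direction of [y] and a part from rounding its
     norm, each at most [(k+1) r] in every coordinate; hence the factor 2. *)
  have -> : in_box (j%:R * (k.+1%:R * r) *: x) (2 * (k.+1%:R * r)) y.
    apply/forallP => i; rewrite mxE.
    have -> : y ord0 i - j%:R * (k.+1%:R * r) * x ord0 i =
       enorm y * (yh - x) ord0 i + (enorm y - j%:R * (k.+1%:R * r)) * x ord0 i.
      by rewrite !mxE; field; rewrite gt_eqF.
    have absle (a b : R) : 0 <= b -> a ^+ 2 <= b ^+ 2 -> `|a| <= b.
      by move=> b0 ab; rewrite -(@ler_pXn2r _ 2) ?nnegrE// real_normK ?num_real.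
    have x1 : `|x ord0 i| <= 1.
      by apply: absle => //; rewrite expr1n -(sphere_dotv sx) coord_le_dotv.
    have ei : `|(yh - x) ord0 i| <= e.
      by apply: absle => //; rewrite enorm_sqr coord_le_dotv.
    have e3 : e <= k.+1%:R * r by rewrite -ler_pdivrMr// ltW.
    rewrite (le_trans (ler_normD _ _))// !normrM mulrDl mul1r lerD//.
      apply: le_trans e3; rewrite gtr0_norm// -[leRHS]mul1r.
      by apply: ler_pM => //; exact: ltW.
    rewrite -[leRHS]mulr1; apply: ler_pM => //.
    move: j1 j2; rewrite ler_pdivlMr// ltr_pdivrMr// -natr1 mulrDl mul1r => j1 j2.
    by rewrite ger0_norm; lra.
  have p0 : 0 < 1 + e / r by lra.
  have kle : k.+1%:R <= 1 + e / r by rewrite -natr1; lra.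
  rewrite mulr1 lef_pV2 ?posrE ?exprn_gt0//.
  by rewrite ler_pXn2r ?nnegrE// ltW.
Qed.

(* Disjoint cubes centred on the ray through [x]: with [N = |y|], [a] the norm of a
   centre and [Q = |y - a x|^2], one has
   [a N |y/N - x|^2 = Q - (N - a)^2]. *)
Lemma box_cover_lower x r w : sphere x -> 0 < r -> r <= 8^-1 -> 0 <= w ->
  exists s : seq (R * 'rV[R]_d.+1 * R),
  [/\ {in s, forall b, 0 <= b.2},
      w / (8 * (2 * d.+1%:R) ^+ d.+1) * r ^+ d <= box_mass s &
      forall y, box_sum s y = 0 \/
        [/\ box_sum s y = w, y != 0, enorm y <= 1 &
            2 - 2 * dotv x ((enorm y)^-1 *: y) <= r ^+ 2]].
Proof.
move=> sx r0 r1 w0.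
pose J := Num.truncn (1 / (4 * r)).
pose D : R := d.+1%:R; have D1 : 1 <= D by rewrite ler1n.
(* In this cube the Euclidean distance to the centre is at most [r / 4], less than half the spacing
   [r] of the centres; this separates the cubes. *)
pose h := r / (4 * D).
have h0 : 0 < h by rewrite divr_gt0// mulr_gt0//; lra.
(* The norms of the centres run from 1/2 to at most 3/4, which keeps the cubes inside the unit ball
   and away from the origin. *)
pose a (j : nat) : R := 2^-1 + j%:R * r.
pose bx j : R * 'rV[R]_d.+1 * R := (w, a j *: x, h).
pose s := [seq bx j | j <- iota 0 J].
have sumE (F : R * 'rV[R]_d.+1 * R -> R) : \sum_(b <- s) F b = \sum_(j < J) F (bx j).
  have e : iota 0 J = index_iota 0 J by rewrite /index_iota subn0.
  by rewrite /s big_map e big_mkord.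
have J0 : 0 <= 1 / (4 * r) by rewrite divr_ge0// mulr_ge0// ltW.
have /andP[J1 J2] := truncn_itv J0.
have r40 : 0 < 4 * r by rewrite mulr_gt0.
exists s; split.
- by move=> b /mapP[j _ ->] /=; exact: ltW.
- rewrite /box_mass sumE /= sumr_const card_ord -[leRHS]mulr_natl.
  (* Since [r <= 8^-1], the number [1 / (4 r)] is at least 2, and rounding it down loses at most
     half. *)
  have h1 : 1 / (8 * r) <= J%:R.
    move: J2; rewrite -/J -(natr1 J).
    have -> : 1 / (4 * r) = 2 * (1 / (8 * r)) by field; rewrite gt_eqF.
    have : 1 <= 1 / (8 * r) by rewrite ler_pdivlMr; lra.
    by lra.
  apply: (@le_trans _ _ (1 / (8 * r) * (w * (2 * h) ^+ d.+1))); last first.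
    by rewrite ler_wpM2r// mulr_ge0// exprn_ge0// mulr_ge0// ltW.
  rewrite le_eqVlt; apply/orP; left; apply/eqP.
  have -> : 2 * h = r / (2 * D) by rewrite /h; field; rewrite gt_eqF//; lra.
  rewrite expr_div_n (exprS r); field.
  by rewrite -/D expf_neq0 ?mulf_neq0// gt_eqF//; lra.
- move=> y; rewrite /box_sum sumE /=.
  pose N := enorm y; have N0 : 0 <= N by exact: enorm_ge0.
  have key (j : 'I_J) : in_box (a j *: x) h y ->
      [/\ y != 0, N <= 1, `|N - a j| <= r / 4 &
          2 - 2 * dotv x ((enorm y)^-1 *: y) <= r ^+ 2].
    move=> /forallP yb.
    have jr : j%:R * r <= 4^-1.
      have : j%:R <= 1 / (4 * r) by rewrite (le_trans _ J1)// ler_nat ltnW.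
      by rewrite ler_pdivlMr//; lra.
    have jr0 : 0 <= j%:R * r by rewrite mulr_ge0// ltW.
    have a0 : 2^-1 <= a j by rewrite /a; lra.
    have a1 : a j <= 3 / 4 by rewrite /a; lra.
    pose Q := dotv (y - a j *: x) (y - a j *: x).
    have Qr : Q <= r ^+ 2 / (16 * D).
      apply: (@le_trans _ _ (D * h ^+ 2)).
        by apply: dotv_le_box; [exact: ltW|move=> i; rewrite !mxE; have := yb i; rewrite mxE].
      rewrite /h le_eqVlt; apply/orP; left; apply/eqP.
      by field; rewrite gt_eqF//; lra.
    have Qr2 : Q <= r ^+ 2 / 16.
      apply: (le_trans Qr); rewrite ler_wpM2l ?sqr_ge0// lef_pV2 ?posrE//; last by lra.
      by rewrite ler_peMr.
    have QE : Q = N ^+ 2 - 2 * a j * dotv y x + a j ^+ 2.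
      rewrite /Q dotvBB dotvZr [dotv (_ *: _) _]dotvZr [dotv (_ *: _) _]dotvC dotvZr.
      by rewrite (sphere_dotv sx) -enorm_sqr -/N; ring.
    have r16 : r ^+ 2 / 16 <= 8^-1 by nra.
    have y0 : y != 0.
      apply/eqP => y0; move: QE; rewrite /N y0.
      have -> : enorm (0 : 'rV[R]_d.+1) = 0.
        by apply/eqP; have := enorm_gt0 (0 : 'rV[R]_d.+1); rewrite eqxx lt0r enorm_ge0 andbT => /negbT /negPn.
      have -> : dotv 0 x = 0 by apply: big1 => i _; rewrite mxE mul0r.
      by nra.
    have Np : 0 < N by rewrite enorm_gt0.
    pose t := dotv x (N^-1 *: y).
    have tE : dotv y x = N * t by rewrite /t dotvZr dotvC; field; rewrite gt_eqF.
    have /andP[_ t1] : -1 <= t <= 1 by apply: sphere_dotv_bound => //; exact: sphere_normalize.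
    rewrite tE in QE.
    have aN : 0 <= a j * N by rewrite mulr_ge0//; lra.
    have NaQ : (N - a j) ^+ 2 <= Q.
      have p : 0 <= a j * N * (1 - t) by apply: mulr_ge0 => //; rewrite subr_ge0.
      by rewrite QE; lra.
    have Na : `|N - a j| <= r / 4.
      rewrite -(@ler_pXn2r _ 2) ?nnegrE ?divr_ge0 ?(ltW r0)// real_normK ?num_real//.
      by apply: (le_trans NaQ); lra.
    have /andP[Nl Nu] : - (r / 4) <= N - a j <= r / 4 by rewrite -ler_norml.
    split; [exact: y0|by lra|exact: Na|].
    rewrite -/N -/t.
    have e : a j * N * (2 - 2 * t) = Q - (N - a j) ^+ 2 by rewrite QE; ring.
    have aN8 : 8^-1 <= a j * N by nra.
    have : 0 <= (2 - 2 * t) * (a j * N - 8^-1) by rewrite mulr_ge0; lra.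
    by have := sqr_ge0 (N - a j); have := sqr_ge0 r; lra.
  case: (pickP (fun j : 'I_J => in_box (a j *: x) h y)) => [j jb|nj]; last first.
    by left; apply: big1 => j _; rewrite nj mulr0.
  have [y0 N1 Na yr] := key j jb.
  right; split => //.
  rewrite (bigD1 j)//= jb mulr1 big1 ?addr0// => i ij.
  case ib: (in_box _ _ _); last by rewrite mulr0.
  have [_ _ Nai _] := key i ib.
  suff : i = j by move/eqP; rewrite (negbTE ij).
  have h1 : `|a i - a j| <= r / 2.
    have -> : a i - a j = (N - a j) - (N - a i) by ring.
    by apply: (le_trans (ler_normB _ _)); lra.
  have h2 : a i - a j = (i%:R - j%:R) * r by rewrite /a; ring.
  have sep (m n : nat) : (m < n)%N -> 1 <= n%:R - m%:R :> R.
    by move=> mn; rewrite lerBrDl natr1 ler_nat.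
  move: h1; rewrite h2 ler_norml => /andP[h3 h4].
  have [/sep lij|/sep lji|eij] := ltngtP (nat_of_ord i) (nat_of_ord j); last exact: ord_inj.
  - by exfalso; have := ler_wpM2r (ltW r0) lij; lra.
  - by exfalso; have := ler_wpM2r (ltW r0) lji; lra.
Qed.

End Covers.

(** * The covariance function near 1 *)

Section ExpBounds.
Variable R : realType.

(** One term of the exponential series suffices for [s > 1]: with [(N + 1) alpha >= n], the power
    [s^n] is at most [(s^alpha)^(N+1)]. *)
Lemma pow_le_expR_powR (c alpha : R) n : 0 < c -> 0 < alpha ->
  exists2 M : R, 0 < M & forall s, 0 <= s -> (1 + s) ^+ n <= M * expR (c * s `^ alpha).
Proof.
move=> c0 a0.
have [N Nn] : exists N : nat, n%:R <= N.+1%:R * alpha.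
  exists (Num.bound (n%:R / alpha)); rewrite -ler_pdivrMr//.
  have h : 0 <= n%:R / alpha :> R by rewrite divr_ge0// ltW.
  by rewrite (le_trans (ltW (archi_boundP h)))// ler_nat.
pose q : R := N.+1`!%:R / c ^+ N.+1.
have q0 : 0 < q by rewrite divr_gt0 ?exprn_gt0// ltr0n fact_gt0.
exists (2 ^+ n * (1 + q)); first by rewrite mulr_gt0 ?exprn_gt0 ?addr_gt0.
move=> s s0; rewrite -mulrA.
have cs0 : 0 <= c * s `^ alpha by rewrite mulr_ge0 ?powR_ge0// ltW.
have E1 : 1 <= expR (c * s `^ alpha) by rewrite -expR0 ler_expR.
have [s1|s1] := leP s 1.
  apply: (@le_trans _ _ (2 ^+ n)).
    by apply: lerXn2r; rewrite ?nnegrE; lra.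
  rewrite ler_peMr ?exprn_ge0//.
  have := mulr_ge0 (ltW q0) (le_trans ler01 E1).
  lra.
apply: (@le_trans _ _ (2 ^+ n * s ^+ n)).
  by rewrite -exprMn; apply: lerXn2r; rewrite ?nnegrE; lra.
rewrite ler_wpM2l ?exprn_ge0//.
apply: (@le_trans _ _ (s `^ (N.+1%:R * alpha))).
  by rewrite -powR_mulrn// ler_powR// ltW.
rewrite (mulrC N.+1%:R) powRrM powR_mulrn ?powR_ge0//.
have := expR_ge1Dxn N cs0; rewrite exprMn.
set z := s `^ alpha ^+ N.+1; set E := expR _ => h.
have z0 : 0 <= z by rewrite exprn_ge0// powR_ge0.
have : c ^+ N.+1 * z / N.+1`!%:R <= E by lra.
have f0 : 0 < N.+1`!%:R :> R by rewrite ltr0n fact_gt0.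
have c1 : 0 < c ^+ N.+1 by rewrite exprn_gt0.
rewrite ler_pdivrMr// mulrC -ler_pdivlMr// => h2.
have -> : (1 + q) * E = E + E * N.+1`!%:R / c ^+ N.+1 by rewrite /q; ring.
by rewrite (le_trans h2)// lerDr expR_ge0.
Qed.

Lemma bernoulli_ineq (x : R) n : 0 <= x <= 1 -> 1 - n%:R * x <= (1 - x) ^+ n.
Proof.
move=> /andP[x0 x1]; elim: n => [|n IH]; first by rewrite expr0 mul0r subr0.
rewrite exprS; have := ler_wpM2l (_ : 0 <= 1 - x) IH.
rewrite subr_ge0 x1 -natr1 => /(_ isT); apply: le_trans.
have : 0 <= n%:R * x * x by rewrite !mulr_ge0.
by lra.
Qed.

End ExpBounds.

Section Cosine.
Variable R : realType.
Implicit Type x : R.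

Lemma sin_le x : 0 <= x -> sin x <= x.
Proof.
rewrite le_eqVlt => /predU1P[<-|x0]; first by rewrite sin0.
have [|y _] := @MVT R sin cos 0 x x0.
  by apply: continuous_subspaceT; exact: continuous_sin.
rewrite sin0 !subr0 => ->; by rewrite ler_piMl ?cos_le1// ltW.
Qed.

Lemma cos_ge x : 1 - x ^+ 2 / 2 <= cos x.
Proof.
wlog x0 : x / 0 <= x => [h|].
  have [/h//|x0] := leP 0 x.
  by rewrite -cosN -sqrrN h// oppr_ge0 ltW.
have [xp|xp] := leP x pi; last first.
  have := pi_ge2 R; have := cos_geN1 x; nra.
have e : cos x = 1 - 2 * sin (x / 2) ^+ 2.
  have -> : x = (x / 2) *+ 2 by rewrite mulr2n; field.
  rewrite cos_mulr2n cos2sin2 mulr2n.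
  have -> : (x / 2) *+ 2 / 2 = x / 2 by rewrite mulr2n; field.
  ring.
have s0 : 0 <= sin (x / 2) by apply: sin_ge0_pi; lra.
have s1 : sin (x / 2) <= x / 2 by apply: sin_le; lra.
rewrite e; nra.
Qed.

(** From [sin x >= x / 2] and [sin^2 x = (1 - cos x) (1 + cos x) <= 2 (1 - cos x)]. With [cos_ge] it
    shows that a small angle lies between its chord and twice its chord. *)
Lemma cos_le x : 0 <= x <= 1 -> cos x <= 1 - x ^+ 2 / 8.
Proof.
move=> /andP[x0 x1].
have s1 : x / 2 <= sin x.
  move: x0; rewrite le_eqVlt => /predU1P[<-|x0]; first by rewrite sin0 mul0r.
  have [|y] := @MVT R sin cos 0 x x0.
    by apply: continuous_subspaceT; exact: continuous_sin.
  rewrite in_itv /= => /andP[y0 yx]; rewrite sin0 !subr0 => ->.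
  by have := cos_ge y; nra.
have := cos2Dsin2 x; have := cos_le1 x; have := cos_geN1 x.
by nra.
Qed.

End Cosine.

Section Kappa.
Variables (R : realType) (kappa : R -> R) (C1 C2 alpha eps : R).
Hypothesis kappa_cont : {within `[-1, 1], continuous kappa}.
Hypotheses (C1_gt0 : 0 < C1) (C2_gt0 : 0 < C2) (alpha_gt0 : 0 < alpha)
  (eps_gt0 : 0 < eps).
Hypothesis kappa_lt1 : forall t, -1 <= t -> t < 1 -> `|kappa t| < 1.
Hypothesis kappa_near1 : forall th : R, `|th| <= eps ->
  C1 * `|th| `^ alpha <= 1 - kappa (cos th) /\
  1 - kappa (cos th) <= C2 * `|th| `^ alpha.

(* [Num.sqrt (2 - 2 * t)] is the chord length of two unit vectors with scalar
   product [t]. *)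
Lemma kappa_bounds : exists c rho C eta : R,
  [/\ 0 < c, 0 < rho < 1, 0 < C, 0 < eta & forall t, -1 <= t <= 1 ->
    [/\ `|kappa t| <= expR (- (c * Num.sqrt (2 - 2 * t) `^ alpha)),
        - rho <= kappa t &
        Num.sqrt (2 - 2 * t) <= eta ->
        1 - C * Num.sqrt (2 - 2 * t) `^ alpha <= kappa t]].
Proof.
have powR_mono (x y : R) : 0 <= x -> x <= y -> x `^ alpha <= y `^ alpha.
  move=> x0 xy; apply: ge0_ler_powR => //; first exact: ltW.
  by rewrite nnegrE (le_trans x0).
(* Inside [e1] the hypothesis on [kappa] and [cos_le] both apply, and [C2 * e1 ^ alpha <= 1] makes
   [kappa] nonnegative. *)
pose e1 := Num.min eps (Num.min 1 (C2^-1 `^ alpha^-1)).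
have e1_gt0 : 0 < e1 by rewrite !lt_min eps_gt0 ltr01 powR_gt0// invr_gt0.
have e1_eps : e1 <= eps by rewrite ge_min lexx.
have e1_1 : e1 <= 1 by rewrite !ge_min lexx orbT.
have e1_C2 : C2 * e1 `^ alpha <= 1.
  rewrite -ler_pdivlMl// mulr1.
  have -> : C2^-1 = (C2^-1 `^ alpha^-1) `^ alpha.
    by rewrite -powRrM mulVf ?gt_eqF// powRr1// invr_ge0 ltW.
  by apply: powR_mono; [exact: ltW|rewrite !ge_min lexx !orbT].
have e1pi : e1 <= pi by have := pi_ge2 R; lra.
have ce1 : -1 <= cos e1 by exact: cos_geN1.
have ce1_lt1 : cos e1 < 1 by have := @cos_le R e1; rewrite e1_1 ltW// => /(_ isT); nra.
have [rho0 rho01 far] : exists2 rho, 0 < rho < 1 &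
    forall t, -1 <= t -> t <= cos e1 -> `|kappa t| <= rho.
  have [|c] := @EVT_max R (fun t => `|kappa t|) _ _ ce1.
    move=> x; apply: continuous_comp; last exact: norm_continuous.
    apply: continuous_subspaceW kappa_cont x.
    by apply: subset_itvl; rewrite bnd_simp ltW.
  rewrite in_itv /= => /andP[cl cu] cmax.
  (* The maximum of [|kappa|] may be 0; the value 1/2 keeps [rho] positive, so that its logarithm
     can be used. *)
  exists (Num.max `|kappa c| 2^-1).
    rewrite gt_max lt_max kappa_lt1 ?(le_lt_trans cu)//= invr_gt0 ltr0n orbT /=.
    by rewrite invf_lt1// ltr1n.
  by move=> t t1 t2; rewrite le_max cmax// in_itv /= t1.
have [rho0_gt0 rho0_lt1] := andP rho01.
(* Near 1 the exponential bound follows from [1 - z <= exp (- z)]; farther away, chords are at most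
   2, so [c * 2 ^ alpha <= - ln rho0] is enough. *)
pose c := Num.min C1 (- ln rho0 / 2 `^ alpha).
have two_gt0 : 0 < 2 `^ alpha :> R by rewrite powR_gt0.
have c_gt0 : 0 < c.
  by rewrite lt_min C1_gt0 divr_gt0// oppr_gt0 ln_lt0.
(* Angles are at most twice their chords, hence [2 ^ alpha]; and a chord of at most [e1 / 4]
   excludes angles above [e1], whose chords are at least [e1 / 2]. *)
exists c, rho0, (C2 * 2 `^ alpha), (e1 / 4); split => //.
- by rewrite mulr_gt0.
- by rewrite divr_gt0.
move=> t t11; have /andP[tl tu] := t11.
pose th := acos t; have th0 : 0 <= th by exact: acos_ge0.
have thpi : th <= pi by exact: acos_lepi.
have cth : cos th = t by rewrite acosK// in_itv.
set dl := Num.sqrt (2 - 2 * t).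
have dl0 : 0 <= dl by exact: sqrtr_ge0.
have dl2 : dl ^+ 2 = 2 - 2 * t by rewrite sqr_sqrtr//; lra.
have sqle (x y : R) : 0 <= x -> 0 <= y -> x ^+ 2 <= y ^+ 2 -> x <= y.
  by move=> x0 y0; rewrite ler_pXn2r.
have dlth : dl <= th.
  by apply: sqle => //; rewrite dl2 -cth; have := cos_ge th; lra.
have [the1|the1] := leP th e1.
  have thabs : `|th| = th by rewrite ger0_norm.
  have := @kappa_near1 th; rewrite thabs cth (le_trans the1 e1_eps) => /(_ isT) [lo hi].
  have thdl : th <= 2 * dl.
    apply: sqle => //; first by rewrite mulr_ge0.
    rewrite exprMn dl2 -cth; have := @cos_le R th.
    by rewrite th0 (le_trans the1 e1_1) => /(_ isT); lra.
  have k0 : 0 <= kappa t.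
    have : C2 * th `^ alpha <= 1.
      by apply: le_trans e1_C2; rewrite ler_pM2l//; exact: powR_mono.
    by lra.
  split.
  - rewrite ger0_norm//.
    have h1 : c * dl `^ alpha <= C1 * th `^ alpha.
      apply: ler_pM; rewrite ?powR_ge0 ?(ltW c_gt0)//; last exact: powR_mono.
      by rewrite ge_min lexx.
    have := expR_ge1Dx (- (c * dl `^ alpha)); lra.
  - by lra.
  - move=> _; have : C2 * th `^ alpha <= C2 * 2 `^ alpha * dl `^ alpha.
      rewrite -mulrA ler_pM2l// -powRM//; exact: powR_mono.
    by lra.
have tce1 : t <= cos e1.
  rewrite -cth leNgt ltr_cos ?in_itv /= ?th0 ?thpi ?(ltW e1_gt0) ?e1pi//.
  by rewrite -leNgt ltW.
have kr := far t tl tce1.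
split.
- apply: (le_trans kr); rewrite -[leLHS]lnK ?posrE// ler_expR -lerN2 opprK.
  have dl_2 : dl <= 2 by apply: sqle => //; rewrite dl2; lra.
  apply: (@le_trans _ _ (- ln rho0 / 2 `^ alpha * 2 `^ alpha)); last first.
    by rewrite divfK// gt_eqF.
  apply: ler_pM; rewrite ?powR_ge0 ?(ltW c_gt0)//; last exact: powR_mono.
  by rewrite ge_min lexx orbT.
- by move: kr; rewrite ler_norml => /andP[].
- move=> dle; exfalso.
  have h : e1 ^+ 2 / 4 <= dl ^+ 2.
    by rewrite dl2; have := @cos_le R e1; rewrite e1_1 ltW// => /(_ isT); lra.
  have : dl ^+ 2 <= (e1 / 4) ^+ 2 by rewrite ler_pXn2r ?nnegrE ?divr_ge0 ?(ltW e1_gt0).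
  by nra.
Qed.

End Kappa.

(** * Spherical integrals of powers of the covariance *)

Section SphereBounds.
Variables (R : realType) (d : nat).
Implicit Types (g : 'rV[R]_d.+1 -> \bar R) (s : seq (R * 'rV[R]_d.+1 * R)).

Lemma sphere_int_le_box g s : {in s, forall b, 0 <= b.2} ->
  (forall y, 0 <= box_sum s y) ->
  (forall y : 'rV[R]_d.+1, y != 0 -> enorm y <= 1 ->
     (g ((enorm y)^-1 *: y)%R <= (box_sum s y)%:E)%E) ->
  (sphere_int g <= (d.+1%:R * box_mass s)%:E)%E.
Proof.
move=> s0 b0 gs; rewrite EFinM -leb_int_box_sum//.
apply: lee_wpmul2l; first by rewrite lee_fin.
apply: le_leb_int => y; case: ifP => [/andP[]|_]; first exact: gs.
by rewrite lee_fin.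
Qed.

Lemma sphere_int_ge_box g s : {in s, forall b, 0 <= b.2} ->
  (forall y : 'rV[R]_d.+1, y != 0 -> enorm y <= 1 ->
     ((box_sum s y)%:E <= g ((enorm y)^-1 *: y)%R)%E) ->
  (forall y : 'rV[R]_d.+1, (y == 0) || (1 < enorm y) -> box_sum s y <= 0) ->
  ((d.+1%:R * box_mass s)%:E <= sphere_int g)%E.
Proof.
move=> s0 gs b0; rewrite EFinM -leb_int_box_sum//.
apply: lee_wpmul2l; first by rewrite lee_fin.
apply: le_leb_int => y; case: ifP => [/andP[]|/negbT]; first exact: gs.
by rewrite negb_and negbK -ltNge lee_fin; exact: b0.
Qed.

Lemma coord_le_enorm (y : 'rV[R]_d.+1) i : `|y ord0 i| <= enorm y.
Proof.
rewrite -(@ler_pXn2r _ 2) ?nnegrE ?enorm_ge0// real_normK ?num_real//.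
by rewrite enorm_sqr coord_le_dotv.
Qed.

Definition unit_box (w : R) : R * 'rV[R]_d.+1 * R := (w, 0, 1).

Lemma in_unit_box (y : 'rV[R]_d.+1) : enorm y <= 1 -> in_box 0 1 y.
Proof.
move=> y1; apply/forallP => i; rewrite mxE subr0.
exact: le_trans (coord_le_enorm y i) y1.
Qed.

(** An upper bound for the volume of the sphere: the cube of side 2 replaces the unit ball in the
    cone formula. *)
Definition sphere_ub : R := d.+1%:R * 2 ^+ d.+1.

Lemma sphere_ub_gt0 : 0 < sphere_ub.
Proof. by rewrite mulr_gt0// exprn_gt0. Qed.

Lemma sphere_int_ub g a : 0 <= a -> (forall y, sphere y -> g y <= a%:E)%E ->
  (sphere_int g <= (sphere_ub * a)%:E)%E.
Proof.
move=> a0 ga; have := @sphere_int_le_box g [:: unit_box a].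
rewrite /box_mass /box_sum !big_seq1 /=.
have -> : d.+1%:R * (a * (2 * 1) ^+ d.+1) = sphere_ub * a :> R.
  by rewrite /sphere_ub mulr1; ring.
apply.
- by move=> b; rewrite inE => /eqP ->.
- by move=> y; rewrite big_seq1 mulr_ge0.
- move=> y y0 y1; rewrite big_seq1 in_unit_box// mulr1.
  by apply: ga; exact: sphere_normalize.
Qed.

Lemma sphere_int_lbN g a : 0 <= a -> (forall y, sphere y -> (- a)%:E <= g y)%E ->
  ((- (sphere_ub * a))%:E <= sphere_int g)%E.
Proof.
move=> a0 ga; have := @sphere_int_ge_box g [:: unit_box (- a)].
rewrite /box_mass /box_sum !big_seq1 /=.
have -> : d.+1%:R * (- a * (2 * 1) ^+ d.+1) = - (sphere_ub * a) :> R.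
  by rewrite /sphere_ub mulr1; ring.
apply.
- by move=> b; rewrite inE => /eqP ->.
- move=> y y0 y1; rewrite big_seq1 in_unit_box// mulr1.
  by apply: ga; exact: sphere_normalize.
- by move=> y _; rewrite big_seq1 mulNr oppr_le0 mulr_ge0.
Qed.

(** A single cube is enough: with all coordinates in [[h, 3h]] it avoids the origin, and
    [h = 1 / (4 D)] puts it inside the unit ball. *)
Lemma sphere_int_lb : exists2 S : R, 0 < S & forall g a, 0 <= a ->
  (forall y, sphere y -> a%:E <= g y)%E -> ((S * a)%:E <= sphere_int g)%E.
Proof.
pose D : R := d.+1%:R; have D1 : 1 <= D by rewrite ler1n.
pose h := (4 * D)^-1.
have h0 : 0 < h by rewrite invr_gt0 mulr_gt0//; lra.
have hD : 4 * D * h = 1 by rewrite divff// gt_eqF// mulr_gt0//; lra.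
exists (D * (2 * h) ^+ d.+1); first by rewrite mulr_gt0 ?exprn_gt0 ?mulr_gt0//; lra.
move=> g a a0 ga.
have key (y : 'rV[R]_d.+1) : in_box (\row__ (2 * h)) h y -> y != 0 /\ enorm y <= 1.
  move=> /forallP yb; have yi i : h <= y ord0 i <= 3 * h.
    by have := yb i; rewrite mxE ler_norml => /andP[? ?]; apply/andP; split; lra.
  split.
    apply/eqP => y0; have /andP[+ _] := yi ord0; rewrite y0 mxE; lra.
  rewrite -(@ler_pXn2r _ 2) ?nnegrE ?enorm_ge0// enorm_sqr expr1n.
  apply: (@le_trans _ _ (D * (3 * h) ^+ 2)).
    apply: dotv_le_box; first by rewrite mulr_ge0// ltW.
    move=> i; have /andP[? ?] := yi i; rewrite ger0_norm//.
    by apply: le_trans (ltW h0) _.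
  have -> : D * (3 * h) ^+ 2 = 4 * D * h * (9 / 4 * h) by field.
  rewrite hD; nra.
have := @sphere_int_ge_box g [:: (a, \row__ (2 * h), h)].
rewrite /box_mass /box_sum !big_seq1 /=.
have -> : d.+1%:R * (a * (2 * h) ^+ d.+1) = D * (2 * h) ^+ d.+1 * a :> R.
  by rewrite /D; ring.
apply.
- by move=> b; rewrite inE => /eqP -> /=; exact: ltW.
- move=> y y0 y1; rewrite big_seq1 /=; have sy := sphere_normalize y0.
  case: (in_box _ _ _); first by rewrite mulr1; exact: ga.
  by rewrite mulr0; apply: le_trans (ga _ sy); rewrite lee_fin.
- move=> y; rewrite big_seq1 /=; case yb: (in_box _ _ _); last by rewrite mulr0.
  by have [/negbTE -> /=] := key y yb; rewrite leNgt => /negbTE ->.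
Qed.

Definition scale_boxes (M : R) s := [seq (M * b.1.1, b.1.2, b.2) | b <- s].

Lemma box_sum_scale M s y : box_sum (scale_boxes M s) y = M * box_sum s y.
Proof.
by rewrite /box_sum big_map mulr_sumr; apply: eq_bigr => b _ /=; rewrite mulrA.
Qed.

Lemma box_mass_scale M s : box_mass (scale_boxes M s) = M * box_mass s.
Proof.
by rewrite /box_mass big_map mulr_sumr; apply: eq_bigr => b _ /=; rewrite mulrA.
Qed.

Lemma scale_boxes_ge0 (M : R) s : {in s, forall b, 0 <= b.2} ->
  {in scale_boxes M s, forall b, 0 <= b.2}.
Proof. by move=> s0 b /mapP[b' b's ->] /=; apply: (s0 b'). Qed.

Variables (kappa : R -> R) (alpha c rho C eta : R).
Hypotheses (alpha_gt0 : 0 < alpha) (c_gt0 : 0 < c) (rho01 : 0 < rho < 1)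
  (C_gt0 : 0 < C) (eta_gt0 : 0 < eta).
Hypothesis kappaP : forall t, -1 <= t <= 1 ->
    [/\ `|kappa t| <= expR (- (c * Num.sqrt (2 - 2 * t) `^ alpha)),
        - rho <= kappa t &
        Num.sqrt (2 - 2 * t) <= eta ->
        1 - C * Num.sqrt (2 - 2 * t) `^ alpha <= kappa t].

Local Notation beta := (d%:R / alpha).
Local Notation inner q x :=
  (sphere_int (fun y : 'rV[R]_d.+1 => (kappa (dotv x y) ^+ q)%:E)).

Let radius (q : nat) : R := q%:R `^ (- alpha^-1).

Let radius_gt0 q : (0 < q)%N -> 0 < radius q.
Proof. by move=> q0; rewrite powR_gt0// ltr0n. Qed.

Let radius_pow q : radius q ^+ d = q%:R `^ (- beta).
Proof.
rewrite -powR_mulrn ?powR_ge0// -powRrM; congr (_ `^ _).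
by rewrite mulNr mulrC.
Qed.

Let radius_alpha q : (0 < q)%N -> radius q `^ alpha = q%:R^-1.
Proof.
by move=> q0; rewrite -powRrM mulNr mulVf ?gt_eqF// powR_inv1.
Qed.

(** At the scale [radius q] the bound [exp (- c q dl^alpha)] becomes a profile independent of [q],
    which [pow_le_expR_powR] dominates by the polynomial profile of [box_cover_upper]. *)
Lemma inner_le : exists2 K : R, 0 < K & forall q x, (0 < q)%N -> sphere x ->
  (inner q x <= (K * q%:R `^ (- beta))%:E)%E.
Proof.
have [M M0 HM] := pow_le_expR_powR d.+3 c_gt0 alpha_gt0.
exists (d.+1%:R * (M * 4 ^+ d.+2)); first by rewrite mulr_gt0// mulr_gt0// exprn_gt0.
move=> q x q0 sx; have r0 := radius_gt0 q0.
have r1 : radius q <= 1.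
  rewrite /radius powRN invf_le1 ?powR_gt0 ?ltr0n// -[leLHS](powRr0 q%:R).
  by rewrite ler_powR ?ler1n// invr_ge0 ltW.
have [s [s0 sm sge slb]] := box_cover_upper sx r0 r1.
apply: (@le_trans _ _ (d.+1%:R * box_mass (scale_boxes M s))%:E); last first.
  have -> : d.+1%:R * (M * 4 ^+ d.+2) * q%:R `^ (- beta)
      = d.+1%:R * (M * (4 ^+ d.+2 * radius q ^+ d)) by rewrite -radius_pow !mulrA.
  by rewrite lee_fin box_mass_scale ler_wpM2l// ler_wpM2l// ltW.
apply: sphere_int_le_box; first exact: scale_boxes_ge0.
  by move=> y; rewrite box_sum_scale mulr_ge0// ltW.
move=> y y0 y1; rewrite box_sum_scale lee_fin.
have := slb y y0 y1.
set t := dotv x _; have t11 : -1 <= t <= 1.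
  by apply: sphere_dotv_bound => //; exact: sphere_normalize.
set dl := Num.sqrt _ => hy.
have [ku _ _] := kappaP t11.
have dl0 : 0 <= dl / radius q by rewrite divr_ge0 ?sqrtr_ge0// ltW.
apply: (le_trans (ler_norm _)); rewrite normrX.
apply: (@le_trans _ _ (expR (- (c * (dl / radius q) `^ alpha)))).
  apply: (@le_trans _ _ (expR (- (c * dl `^ alpha)) ^+ q)).
    by apply: lerXn2r; [exact: normr_ge0|exact: expR_ge0|exact: ku].
  rewrite -expRM_natl ler_expR powRM ?invr_ge0 ?sqrtr_ge0 ?(ltW r0)//.
  rewrite -(powR_inv1 (ltW r0)) -powRrM mulN1r powRN radius_alpha// invrK.
  by rewrite le_eqVlt; apply/orP; left; apply/eqP; ring.
apply: (@le_trans _ _ (M * ((1 + dl / radius q) ^+ d.+3)^-1)); last first.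
  by rewrite ler_wpM2l// ltW.
rewrite expRN -[leLHS]div1r ler_pdivrMr ?expR_gt0//.
have p0 : 0 < (1 + dl / radius q) ^+ d.+3 by rewrite exprn_gt0//; lra.
by rewrite mulrAC ler_pdivlMr// mul1r; exact: HM.
Qed.

(** The spare factor [1 / q] lets the negative contribution be absorbed for large [q]. *)
Let rho_pow_le : exists2 M : R, 0 < M & forall q, (0 < q)%N ->
  rho ^+ q <= M * q%:R `^ (- beta) / q%:R.
Proof.
have [r0 r1] := andP rho01.
have l0 : 0 < - ln rho by rewrite oppr_gt0 ln_lt0.
pose n := Num.bound (beta + 1).
have b0 : 0 <= beta + 1 by rewrite addr_ge0// divr_ge0// ltW.
have nb : beta + 1 <= n%:R := ltW (archi_boundP b0).
have [M M0 HM] := pow_le_expR_powR n l0 (ltr01 : 0 < 1 :> R).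
exists M => // q q0; have q1 : 1 <= q%:R :> R by rewrite ler1n.
have qp : 0 < q%:R :> R by lra.
have h := HM q%:R (ltW qp); rewrite powRr1 ?(ltW qp)// in h.
have e : expR (- ln rho * q%:R) = (rho ^+ q)^-1.
  by rewrite mulNr expRN mulrC expRM_natl lnK// posrE.
rewrite e in h.
have rq0 : 0 < rho ^+ q by rewrite exprn_gt0.
have -> : M * q%:R `^ (- beta) / q%:R = M / q%:R `^ (beta + 1).
  have -> : q%:R `^ (beta + 1) = q%:R `^ beta * q%:R :> R.
    by rewrite powRD ?powRr1 ?(ltW qp)// (gt_eqF qp) implybT.
  by rewrite powRN; field; rewrite !gt_eqF// powR_gt0.
rewrite ler_pdivlMr ?powR_gt0// mulrC -ler_pdivlMr//.
apply: le_trans h; apply: (@le_trans _ _ (q%:R ^+ n)).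
  by rewrite -powR_mulrn ?(ltW qp)// ler_powR.
by apply: lerXn2r; rewrite ?nnegrE; lra.
Qed.

(** Within distance [z * radius q] of [x], Bernoulli's inequality gives [kappa^q >= 1/2]; elsewhere
    [kappa^q >= - rho^q]. The cubes of [box_cover_lower] carry the first bound, one large cube of
    weight [- rho^q] the second. *)
Lemma inner_ge : exists2 K : R, 0 < K & exists q0 : nat, forall q x,
  (q0 <= q)%N -> sphere x -> ((K * q%:R `^ (- beta))%:E <= inner q x)%E.
Proof.
have [M M0 HM] := rho_pow_le; have [r0 r1] := andP rho01.
(* The three bounds serve [box_cover_lower], the range of the local estimate on [kappa], and
   [C * r ^ alpha <= 1 / (2 q)]. *)
pose z := Num.min 8^-1 (Num.min eta ((2 * C)^-1 `^ alpha^-1)).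
have iC0 : 0 < (2 * C)^-1 by rewrite invr_gt0 mulr_gt0.
have z0 : 0 < z by rewrite !lt_min eta_gt0 powR_gt0// invr_gt0 ltr0n.
have z8 : z <= 8^-1 by rewrite ge_min lexx.
have zeta : z <= eta by rewrite !ge_min lexx orbT.
have zC : C * z `^ alpha <= 2^-1.
  rewrite -ler_pdivlMl//; have -> : C^-1 * 2^-1 = ((2 * C)^-1 `^ alpha^-1) `^ alpha.
    rewrite -powRrM mulVf ?gt_eqF// powRr1 ?(ltW iC0)//.
    by field; rewrite gt_eqF.
  apply: ge0_ler_powR; rewrite ?nnegrE ?powR_ge0 ?(ltW z0) ?(ltW alpha_gt0)//.
  by rewrite !ge_min lexx !orbT.
pose A := 2^-1 / (8 * (2 * d.+1%:R) ^+ d.+1) * z ^+ d.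
have A0 : 0 < A.
  have d0 : 0 < 2 * d.+1%:R :> R by rewrite mulr_gt0.
  by apply: mulr_gt0; [apply: divr_gt0 => //; apply: mulr_gt0 => //|];
    apply: exprn_gt0.
exists (d.+1%:R * (A / 2)); first by rewrite mulr_gt0// divr_gt0.
(* From [q >= L] on, the negative mass is at most half of the positive mass [A q^{-beta}]. *)
pose L := 2 * (M * 2 ^+ d.+1) / A.
have L0 : 0 < L by rewrite divr_gt0// mulr_gt0// mulr_gt0// exprn_gt0.
exists (Num.bound L).+1 => q x qL sx.
have q0 : (0 < q)%N by apply: leq_trans qL.
have qp : 0 < q%:R :> R by rewrite ltr0n.
have Lq : L <= q%:R.
  apply: (le_trans (ltW (archi_boundP (ltW L0)))); rewrite ler_nat.
  exact: ltnW.
have rad0 := radius_gt0 q0.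
have rad1 : radius q <= 1.
  rewrite /radius powRN invf_le1 ?powR_gt0// -[leLHS](powRr0 q%:R).
  by rewrite ler_powR ?ler1n// invr_ge0 ltW.
pose r := z * radius q.
have rp : 0 < r by rewrite mulr_gt0.
have rz : r <= z by rewrite /r ler_piMr// ltW.
have w0 : 0 <= 2^-1 :> R by rewrite invr_ge0.
have [s [s0 sm sP]] := box_cover_lower sx rp (le_trans rz z8) w0.
have rq0 : 0 <= rho ^+ q by rewrite exprn_ge0// ltW.
apply: (@le_trans _ _ (d.+1%:R * box_mass (unit_box (- rho ^+ q) :: s))%:E).
  rewrite lee_fin -mulrA ler_wpM2l// /box_mass big_cons /= mulr1 -/(box_mass s).
  apply: (@le_trans _ _ (- rho ^+ q * 2 ^+ d.+1 + A * q%:R `^ (- beta))); last first.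
    rewrite lerD2l; apply: le_trans sm.
    by rewrite /r /A (exprMn _ z) radius_pow mulrA.
  have h1 : rho ^+ q * 2 ^+ d.+1 <= A / 2 * q%:R `^ (- beta).
    apply: (@le_trans _ _ (M * q%:R `^ (- beta) / q%:R * 2 ^+ d.+1)).
      by rewrite ler_wpM2r ?exprn_ge0// HM.
    have -> : M * q%:R `^ (- beta) / q%:R * 2 ^+ d.+1
       = (M * 2 ^+ d.+1 / q%:R) * q%:R `^ (- beta) by ring.
    rewrite ler_wpM2r ?powR_ge0// ler_pdivrMr//.
    move: Lq; rewrite /L ler_pdivrMr//; lra.
  by lra.
apply: sphere_int_ge_box.
- move=> b; rewrite inE => /predU1P[->//|]; exact: s0.
- move=> y y0 y1; rewrite lee_fin /box_sum big_cons /= in_unit_box// mulr1.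
  rewrite -/(box_sum s y).
  set t := dotv x _; have t11 : -1 <= t <= 1.
    by apply: sphere_dotv_bound => //; exact: sphere_normalize.
  have [_ kl kn] := kappaP t11.
  have [->|[-> _ _ tr]] := sP y.
    rewrite addr0; have [k0|k0] := leP 0 (kappa t).
      by apply: (@le_trans _ _ 0); rewrite ?oppr_le0// exprn_ge0.
    have : `|kappa t ^+ q| <= rho ^+ q.
      rewrite normrX; apply: lerXn2r; rewrite ?nnegrE ?normr_ge0 ?(ltW r0)//.
      by rewrite ltr0_norm//; lra.
    by rewrite ler_norml => /andP[].
  have dr : Num.sqrt (2 - 2 * t) <= r.
    rewrite -(@ler_pXn2r _ 2) ?nnegrE ?sqrtr_ge0 ?(ltW rp)// sqr_sqrtr//.
    by have /andP[] := t11; lra.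
  have kt := kn (le_trans dr (le_trans rz zeta)).
  have h1 : C * Num.sqrt (2 - 2 * t) `^ alpha <= (2 * q%:R)^-1.
    apply: (@le_trans _ _ (C * r `^ alpha)).
      rewrite ler_wpM2l ?(ltW C_gt0)//; apply: ge0_ler_powR;
        by rewrite ?nnegrE ?sqrtr_ge0 ?(ltW alpha_gt0) ?(ltW rp).
    rewrite /r powRM ?(ltW z0) ?(ltW rad0)// radius_alpha// mulrA invfM.
    by rewrite ler_wpM2r// invr_ge0 ltW.
  have q1 : 1 <= q%:R :> R by rewrite ler1n.
  have iq : 0 <= (2 * q%:R : R)^-1 <= 1.
    by rewrite invr_ge0 mulr_ge0 ?(ltW qp)//= invf_le1 ?mulr_gt0//; lra.
  have := bernoulli_ineq q iq.
  have -> : 1 - q%:R * (2 * q%:R)^-1 = 2^-1 :> R by field; rewrite gt_eqF.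
  move=> h2; apply: (@le_trans _ _ 2^-1); first by lra.
  apply: (le_trans h2); apply: lerXn2r; rewrite ?nnegrE; last by lra.
    by have /andP[] := iq; lra.
  by have /andP[] := iq; lra.
- move=> y yout; rewrite /box_sum big_cons /= -/(box_sum s y).
  have [->|[_ y0 y1 _]] := sP y.
    by rewrite addr0 mulNr oppr_le0 mulr_ge0.
  by move: yout; rewrite (negbTE y0) /= ltNge y1.
Qed.

Lemma kint_fin q : kint d kappa q \is a fin_num.
Proof.
have b (x y : 'rV[R]_d.+1) : sphere x -> sphere y -> -1 <= kappa (dotv x y) ^+ q <= 1.
  move=> sx sy; have t11 := sphere_dotv_bound sx sy.
  have [ku _ _] := kappaP t11.
  rewrite -ler_norml normrX; apply: exprn_ile1 => //; apply: (le_trans ku).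
  by rewrite -expR0 ler_expR oppr_le0 mulr_ge0 ?powR_ge0// ltW.
have S0 := ltW sphere_ub_gt0.
have lo x : sphere x -> ((- (sphere_ub * 1))%:E <= inner q x)%E.
  move=> sx; apply: sphere_int_lbN => // y sy; rewrite lee_fin.
  by have /andP[] := b x y sx sy.
have hi x : sphere x -> (inner q x <= (sphere_ub * 1)%:E)%E.
  move=> sx; apply: sphere_int_ub => // y sy; rewrite lee_fin.
  by have /andP[] := b x y sx sy.
have S1 : 0 <= sphere_ub * 1 by rewrite mulr1.
rewrite fin_numE; apply/andP; split.
  by rewrite -ltNye (lt_le_trans _ (sphere_int_lbN S1 lo))// ltNyr.
by rewrite -ltey (le_lt_trans (sphere_int_ub S1 hi))// ltry.
Qed.

Lemma kint_asymp : exists c' C' (q0 : nat), [/\ 0 < c', 0 < C' & forall q, (q0 <= q)%N ->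
  c' * q%:R `^ (- beta) <= fine (kint d kappa q) <= C' * q%:R `^ (- beta)].
Proof.
have [K K0 HK] := inner_le; have [k k0 [q0 Hk]] := inner_ge.
have [S S0 HS] := sphere_int_lb.
exists (S * k), (sphere_ub * K), q0.+1; split; rewrite ?mulr_gt0 ?sphere_ub_gt0//.
move=> q qq0; have qp : (0 < q)%N by apply: leq_trans qq0.
have b0 : 0 <= q%:R `^ (- beta) by exact: powR_ge0.
rewrite -!lee_fin fineK ?kint_fin// -(mulrA S) -(mulrA sphere_ub); apply/andP; split.
  apply: HS; first by rewrite mulr_ge0// ltW.
  by move=> x sx; apply: Hk => //; exact: ltnW.
apply: (@sphere_int_ub _ (K * q%:R `^ (- beta))); first by rewrite mulr_ge0// ltW.
by move=> x sx; apply: HK.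
Qed.

End SphereBounds.

(** * Convergence of the series *)

Section Series.
Variable R : realType.

(** The sign of the first terms is left open, so monotone convergence is applied to the partial sums
    shifted by [n1]. *)
Lemma eseries_lt_pinfty (t : nat -> R) n1 : (forall n, (n1 <= n)%N -> 0 <= t n) ->
  (\sum_(0 <= q <oo) (t q)%:E < +oo)%E <->
  exists B, forall N, (n1 <= N)%N -> \sum_(0 <= q < N) t q <= B.
Proof.
move=> t0; pose u N := (\sum_(0 <= q < N) (t q)%:E)%E.
have uE N : u N = (\sum_(0 <= q < N) t q)%:E by rewrite /u sumEFin.
pose v k := u (k + n1)%N.
have nd : nondecreasing_seq v.
  apply/nondecreasing_seqP => k; rewrite /v !uE lee_fin addSn big_nat_recr//= lerDl.
  by apply: t0; exact: leq_addl.
have cv : u n @[n --> \oo] --> ereal_sup (range v).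
  have := ereal_nondecreasing_cvgn nd.
  by rewrite /v (cvg_shiftn n1 u).
have -> : (\sum_(0 <= q <oo) (t q)%:E)%E = ereal_sup (range v) by exact/cvg_lim.
split=> [lt|[B HB]]; last first.
  apply: (@le_lt_trans _ _ B%:E); last exact: ltry.
  apply: ge_ereal_sup => _ [k _ <-]; rewrite /v uE lee_fin; apply: HB.
  exact: leq_addl.
have ub N : (n1 <= N)%N -> (u N <= ereal_sup (range v))%E.
  by move=> nN; apply: ereal_sup_ubound; exists (N - n1)%N => //; rewrite /v subnK.
case E : (ereal_sup (range v)) lt ub => [B| |] // _ ub.
  by exists B => N /ub; rewrite uE lee_fin.
by have := ub n1 (leqnn _); rewrite uE leeNy_eq.
Qed.

(* Integral comparison: [x^{-1-dl}] is minus the derivative of [x^{-dl} / dl]. *)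
Lemma powR_telescope (dl : R) n : 0 < dl ->
  n.+2%:R `^ (- 1 - dl) <= dl^-1 * (n.+1%:R `^ (- dl) - n.+2%:R `^ (- dl)).
Proof.
move=> d0; set y : R := n.+2%:R; set x : R := n.+1%:R.
have x0 : 0 < x by rewrite ltr0n.
have y0 : 0 < y by rewrite ltr0n.
have yx : y = x + 1 by rewrite /y -(natr1 n.+1).
have -> : y `^ (- 1 - dl) = y^-1 * y `^ (- dl).
  by rewrite powRD ?(gt_eqF y0) ?implybT// powR_inv1// ltW.
rewrite ler_pdivlMl//.
suff h : (1 + dl / y) * y `^ (- dl) <= x `^ (- dl).
  have -> : dl * (y^-1 * y `^ (- dl)) = (1 + dl / y) * y `^ (- dl) - y `^ (- dl) by ring.
  by rewrite lerB.
have xy : x = y * (1 - y^-1) by rewrite mulrBr mulr1 divff ?gt_eqF// yx; ring.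
have z0 : 0 < 1 - y^-1 by rewrite -(pmulr_rgt0 _ y0) -xy.
rewrite [in leRHS]xy powRM ?(ltW y0) ?(ltW z0)// mulrC ler_wpM2l ?powR_ge0//.
rewrite /powR gt_eqF//.
apply: (le_trans (expR_ge1Dx _)); rewrite ler_expR mulNr -mulrN ler_wpM2l ?(ltW d0)//.
have : ln (1 - y^-1) <= - y^-1.
  by apply: le_ln1Dx; rewrite ltrN2 invf_lt1// /y ltr1n.
by rewrite lerNr.
Qed.

Lemma bounded_sum_powR (t : nat -> R) (C dl : R) n1 : 0 < dl -> 0 <= C ->
  (forall n, (n1 <= n)%N -> t n <= C * n%:R `^ (- 1 - dl)) ->
  exists B, forall N, (n1 <= N)%N -> \sum_(0 <= q < N) t q <= B.
Proof.
(* [powR_telescope] covers the indices from 2 on; the partial sums at [n1] and [n1.+1] enter the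
   final maximum. *)
move=> d0 C0 tC; set m := n1.+2.
pose S N := \sum_(0 <= q < N) t q.
have SS N : S N.+1 = S N + t N by rewrite /S big_nat_recr.
have h N : (m <= N)%N -> S N <= S m + C / dl * (1 - N.-1%:R `^ (- dl)).
  elim: N => // N IH; rewrite leq_eqVlt => /predU1P[<-|].
    rewrite lerDl mulr_ge0 ?divr_ge0 ?(ltW d0)// subr_ge0 powRN invf_le1 ?powR_gt0//.
    by rewrite -[leLHS](powRr0 m.-1%:R) ler_powR ?ler1n// ltW.
  rewrite ltnS => mN; rewrite SS.
  case: N => [|[|N]] in IH mN *; [by rewrite /m in mN|by rewrite /m in mN|].
  have h1 := IH mN.
  have h2 : t N.+2 <= C * (dl^-1 * (N.+1%:R `^ (- dl) - N.+2%:R `^ (- dl))).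
    apply: (le_trans (tC _ _)); first by rewrite (leq_trans _ mN)// /m; lia.
    by rewrite ler_wpM2l// powR_telescope.
  apply: (le_trans (lerD h1 h2)); rewrite /=.
  by rewrite le_eqVlt; apply/orP; left; apply/eqP; ring.
exists (Num.max (S n1) (Num.max (S n1.+1) (S m + C / dl))) => N.
rewrite leq_eqVlt => /predU1P[<-|]; first by rewrite le_max lexx.
rewrite leq_eqVlt => /predU1P[<-|]; first by rewrite !le_max lexx orbT.
move=> mN; rewrite !le_max; apply/orP; right; apply/orP; right.
by apply: (le_trans (h N mN)); rewrite lerD2l ler_piMr ?divr_ge0 ?(ltW d0)// gerBl.
Qed.

(** [S N + S N.+1] grows by exactly [t N + t N.+1], so bounds on overlapping pairs add up to the
    harmonic series. *)
Lemma unbounded_sum_pairs (t : nat -> R) (c : R) n1 : 0 < c ->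
  (forall n, (n1 <= n)%N -> c * harmonic n <= t n + t n.+1) ->
  ~ exists B, forall N, (n1 <= N)%N -> \sum_(0 <= q < N) t q <= B.
Proof.
move=> c0 tc [B HB]; apply: (@dvg_harmonic R).
pose S N := \sum_(0 <= q < N) t q.
have SS N : S N.+1 = S N + t N by rewrite /S big_nat_recr.
pose K := c * series (@harmonic R) n1 - S n1 - S n1.+1.
have h N : (n1 <= N)%N -> c * series (@harmonic R) N - K <= S N + S N.+1.
  elim: N => [|N IH].
    by rewrite leqn0 => /eqP e; rewrite /K e; lra.
  rewrite leq_eqVlt => /predU1P[<-|]; first by rewrite /K; lra.
  rewrite ltnS => nN; have := IH nN; have := tc _ nN.
  have -> : series (@harmonic R) N.+1 = series (@harmonic R) N + harmonic N.
    by rewrite /series /= big_nat_recr.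
  by rewrite !SS; lra.
have nd : nondecreasing_seq (series (@harmonic R)).
  apply/nondecreasing_seqP => n; rewrite /series /= big_nat_recr//= lerDl.
  exact: harmonic_ge0.
apply: nondecreasing_is_cvgn => //.
exists ((2 * B + K) / c) => _ [N _ <-].
rewrite ler_pdivlMr// mulrC.
apply: (@le_trans _ _ (c * series (@harmonic R) (N + n1)%N)).
  by rewrite ler_pM2l//; apply: nd; exact: leq_addr.
have := h _ (leq_addl N n1); have := HB _ (leq_addl N n1).
have := HB _ (leqW (leq_addl N n1)); rewrite -/(S _) -/(S _); lra.
Qed.

End Series.

(** * The chaos norm of the indicator of a half-line *)

Section ChaosNorm.
Variables (R : realType) (d : nat) (kappa : R -> R) (u beta c' C' : R)
  (p q0 : nat).
Hypotheses (c'_gt0 : 0 < c') (C'_gt0 : 0 < C').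
Hypothesis kint_finite : forall q, kint d kappa q \is a fin_num.
Hypothesis kint_bounds : forall q, (q0 <= q)%N ->
  c' * q%:R `^ (- beta) <= fine (kint d kappa q) <= C' * q%:R `^ (- beta).

Let t q : R :=
  q%:R ^+ p * q`!%:R * hcoef (ind_ge u) q ^+ 2 * fine (kint d kappa q).
Let g : R := gdens u ^+ 2.

Let g_gt0 : 0 < g. Proof. by rewrite exprn_gt0// gdens_gt0. Qed.

(** The factorials leave one factor [1 / (q+1)] beside the normalised square; it is the [- 1] in the
    exponent [p - 1 - beta]. *)
Let tE q : t q.+1 = g * hermite_sq u q * (q.+1%:R ^+ p / q.+1%:R * fine (kint d kappa q.+1)).
Proof.
rewrite /t hcoef_ind_ge /g /hermite_sq factS natrM.
have f0 : 0 < q`!%:R :> R by rewrite ltr0n fact_gt0.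
have n0 : 0 < q.+1%:R :> R by [].
by move: (q.+1%:R) n0 => n n0; field; rewrite !gt_eqF.
Qed.

Let pow_kint q : (q0 <= q.+1)%N ->
  c' * q.+1%:R `^ (p%:R - 1 - beta) <=
    q.+1%:R ^+ p / q.+1%:R * fine (kint d kappa q.+1)
  <= C' * q.+1%:R `^ (p%:R - 1 - beta).
Proof.
move=> qq; have /andP[lo hi] := kint_bounds qq.
have n0 : 0 < q.+1%:R :> R by [].
have e0 : 0 <= q.+1%:R ^+ p / q.+1%:R :> R by rewrite divr_ge0 ?exprn_ge0.
have -> : q.+1%:R `^ (p%:R - 1 - beta) = q.+1%:R ^+ p / q.+1%:R * q.+1%:R `^ (- beta) :> R.
  rewrite powRD ?(gt_eqF n0) ?implybT// powRD ?(gt_eqF n0) ?implybT//.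
  by rewrite powR_mulrn ?ler0n// powR_inv1 ?ler0n.
by rewrite !(mulrCA _ (q.+1%:R ^+ p / q.+1%:R)) !ler_wpM2l.
Qed.

Lemma in_Dp2_ind_ge : in_Dp2 d kappa p (ind_ge u) <-> p%:R < beta + 2^-1.
Proof.
have [c [C [n0 [c0 C0 hb]]]] := hermite_pair_asymp u.
pose n1 := (maxn q0 n0).+1.
have sqrtE n : Num.sqrt n.+1%:R = n.+1%:R `^ 2^-1 :> R by rewrite powR12_sqrt.
have n1P n : (n1 <= n.+1)%N -> (q0 <= n.+1)%N /\ (n0 <= n)%N.
  by rewrite /n1 ltnS geq_max => /andP[? ?]; split => //; exact: leqW.
have t0 n : (n1 <= n)%N -> 0 <= t n.
  case: n => // n /n1P[nq nn]; rewrite tE mulr_ge0//.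
    by rewrite mulr_ge0 ?hermite_sq_ge0// ltW.
  have /andP[lo _] := pow_kint nq; apply: le_trans lo.
  by rewrite mulr_ge0 ?powR_ge0// ltW.
have -> : in_Dp2 d kappa p (ind_ge u) = (\sum_(0 <= q <oo) (t q)%:E < +oo)%E.
  rewrite /in_Dp2; congr (_ < _)%E; apply: eq_eseriesr => q _.
  by rewrite /t [RHS]EFinM fineK.
apply: (iff_trans (eseries_lt_pinfty t0)); split => [bd|pb].
  rewrite ltNge; apply/negP => pb; move: bd.
  apply: (@unbounded_sum_pairs _ _ (g * (c' * c)) n1).
    by rewrite mulr_gt0// mulr_gt0.
  case=> // n nn; have [nq nn0] := n1P _ nn.
  have [_ hp] := hb _ nn0; have [nq' _] := n1P _ (leqW nn).
  have /andP[lo1 _] := pow_kint nq; have /andP[lo2 _] := pow_kint nq'.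
  have gh0 m : 0 <= g * hermite_sq u m.
    by apply: mulr_ge0; [exact: ltW|exact: hermite_sq_ge0].
  (* For [p >= beta + 1/2] the exponent [p - 1 - beta] is at least [- 1/2], so [x] bounds from
     below, up to constants, both the Hermite pair and the remaining factor; [x * x] is a harmonic
     term, also in the case of equality. *)
  pose x : R := n.+2%:R `^ (- 2^-1).
  have x0 : 0 <= x by exact: powR_ge0.
  have pw (m : nat) : (m <= n.+1)%N -> x <= m.+1%:R `^ (p%:R - 1 - beta).
    move=> mn; apply: (@le_trans _ _ (m.+1%:R `^ (- 2^-1))).
      rewrite /x !powRN lef_pV2 ?posrE ?powR_gt0//.
      by apply: ge0_ler_powR; rewrite ?nnegrE ?invr_ge0// ler_nat.
    by rewrite ler_powR ?ler1n//; lra.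
  have h1 : g * hermite_sq u n * (c' * x) <= t n.+1.
    rewrite tE; apply: ler_wpM2l; first exact: gh0.
    by apply: le_trans lo1; apply: ler_wpM2l; [exact: ltW|exact: pw].
  have h2 : g * hermite_sq u n.+1 * (c' * x) <= t n.+2.
    rewrite tE; apply: ler_wpM2l; first exact: gh0.
    by apply: le_trans lo2; apply: ler_wpM2l; [exact: ltW|exact: pw].
  apply: le_trans (lerD h1 h2); rewrite -mulrDl -mulrDr.
  have h3 : c * x <= hermite_sq u n + hermite_sq u n.+1.
    apply: le_trans hp; rewrite ler_wpM2l ?(ltW c0)// sqrtE -powRN.
    rewrite /x !powRN lef_pV2 ?posrE ?powR_gt0//.
    by apply: ge0_ler_powR; rewrite ?nnegrE ?invr_ge0// ler_nat.
  have xx : x * x = harmonic n.+1.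
    rewrite /x -powRD ?pnatr_eq0 ?implybT//.
    have -> : - 2^-1 + - 2^-1 = -1 :> R by field.
    by rewrite powR_inv1.
  rewrite -xx; have -> : g * (c' * c) * (x * x) = g * (c * x) * (c' * x) by ring.
  by rewrite ler_wpM2r ?mulr_ge0 ?(ltW c'_gt0)// ler_wpM2l ?(ltW g_gt0).
(* The excess over the harmonic exponent is exactly the gap [beta + 1/2 - p] in the strict
   inequality. *)
apply: (@bounded_sum_powR _ _ (g * (C' * C)) (beta + 2^-1 - p%:R)).
- by rewrite subr_gt0.
- by apply: ltW; rewrite mulr_gt0// mulr_gt0.
case=> // n nn; have [nq nn0] := n1P _ nn.
have [hu _] := hb _ nn0; have /andP[_ hi] := pow_kint nq.
have -> : -1 - (beta + 2^-1 - p%:R) = (p%:R - 1 - beta) + - 2^-1 by ring.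
rewrite powRD ?pnatr_eq0 ?implybT//; set y := _ `^ (_ - _).
set z := _ `^ (- _).
have -> : g * (C' * C) * (y * z) = g * (C * z) * (C' * y) by ring.
have y0 : 0 <= y by exact: powR_ge0.
have z0 : 0 <= z by exact: powR_ge0.
rewrite tE -/y in hi *; apply: (@le_trans _ _ (g * hermite_sq u n * (C' * y))).
  apply: ler_wpM2l => //.
  by apply: mulr_ge0; [exact: ltW|exact: hermite_sq_ge0].
apply: ler_wpM2r; first by apply: mulr_ge0 => //; exact: ltW.
apply: ler_wpM2l; first exact: ltW.
by rewrite /z powRN -sqrtE.
Qed.

End ChaosNorm.

Theorem mainTheorem7 (R : realType) (d : nat) (kappa : R -> R)
    (dT : measure_display) (T : measurableType dT) (P : probability T R)
    (B : 'rV[R]_d.+1 -> T -> R) (C1 C2 alpha eps : R) :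
  (0 < d)%N ->
  (* B is a jointly measurable field on S^d *)
  (forall x, sphere x -> measurable_fun setT (B x)) ->
  measurable_fun (setT `*` (@sphere R d : set (BorelRV R d)))
    (fun z : T * BorelRV R d => B z.2 z.1) ->
  (* B is a centered Gaussian field *)
  (forall cs : seq ('rV[R]_d.+1 * R), (forall xc, xc \in cs -> sphere xc.1) ->
     exists2 v : R, 0 <= v &
       forall A : set R, measurable A ->
         P (lincomb B cs @^-1` A) = gauss_law v A) ->
  (forall x, sphere x -> (\int[P]_w (B x w)%:E = 0)%E) ->
  (* with covariance kappa(<x,y>) *)
  (forall x y, sphere x -> sphere y ->
     (\int[P]_w (B x w * B y w)%:E = (kappa (dotv x y))%:E)%E) ->
  (* isotropy: the finite-dimensional laws are rotation invariant *)
  (forall M : 'M[R]_d.+1, M *m M^T = 1%:M ->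
     forall cs : seq ('rV[R]_d.+1 * R), (forall xc, xc \in cs -> sphere xc.1) ->
     forall A : set R, measurable A ->
       P (lincomb B [seq (xc.1 *m M, xc.2) | xc <- cs] @^-1` A)
       = P (lincomb B cs @^-1` A)) ->
  {within `[-1, 1], continuous kappa} ->
  kappa 1 = 1 ->
  0 < C1 -> 0 < C2 -> 0 < alpha -> 0 < eps ->
  (forall t, -1 <= t -> t < 1 -> `|kappa t| < 1) ->
  (forall th : R, `|th| <= eps ->
     C1 * `|th| `^ alpha <= 1 - kappa (cos th) /\
     1 - kappa (cos th) <= C2 * `|th| `^ alpha) ->
  forall (u : R) (p : nat),
    in_Dp2 d kappa p (ind_ge u) <-> p%:R < d%:R / alpha + 2^-1.
Proof.
move=> _ _ _ _ _ _ _ kc _ C1p C2p ap ep klt knear u p.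
have [c [rho [C [eta [c0 rho01 C0 eta0 kP]]]]] :=
  kappa_bounds kc C1p C2p ap ep klt knear.
have [c' [C' [q0 [c'0 C'0 kb]]]] := kint_asymp d ap c0 rho01 C0 eta0 kP.
exact: (in_Dp2_ind_ge u p c'0 C'0 (kint_fin d c0 kP) kb).
Qed.
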